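(* For every integer $k\geq 4$, the symmetry algebra (Lie algebra of point symmetries) of the ordinary differential equation $$y^{(k)}-\sum_{q=1}^{k-3}\frac{a_q\,(y'')^{q}\,y^{(k-q)}\,(y')^{k-2-q}}{(y')^{k-2}}-\frac{a_{k-2}\,(y'')^{k-1}}{(y')^{k-2}}+\left(y+\frac{2y'y'''-3(y'')^{2}}{(y')^{4}}\right)(y')^{k}=0$$ for $y=y(x)$, with the coefficients $a_1,\dots,a_{k-2}$ (depending on $k$) defined in the context, is isomorphic to $\mathfrak{sl}(2,\mathbb{R})$.
   Context: For $k\geq 4$, the coefficients $(a_q)_{1\leq q\leq k-2}$ are those for which the equation $$y^{(k)}-\sum_{q=1}^{k-3}\frac{a_q\,(y'')^{q}\,y^{(k-q)}\,(y')^{k-2-q}}{(y')^{k-2}}-a_{k-2}\frac{(y'')^{k-1}}{(y')^{k-2}}=0$$ is invariant under $\mathfrak{sl}(2,\mathbb{R})$ realized by the vector fields $X_1=x\partial_x$, $X_2=\partial_x$, $X_3=x^2\partial_x$. They are the unique solution of the linear system $$2a_1-f(k)=0,$$ $$2q\,a_q+f(k+1-q)\,a_{q-1}=0\quad (2\leq q\leq k-3),$$ $$2(k-1)\,a_{k-2}+f(3)\,a_{k-3}=0,$$ where $f(k+1-q):=k^2+k-2kq-q+q^2$ for $1\leq q\leq k-2$ (so $f(k)=k^2-k$ and $f(3)=6$). A vector field $X=\xi(x,y)\partial_x+\eta(x,y)\partial_y$, with smooth coefficients on a connected open subset of the $(x,y)$-plane, is a (Lie) point symmetry of a $k$-th order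 ordinary differential equation $E(x,y,y',\dots,y^{(k)})=0$ if its $k$-th order prolongation $X^{(k)}$ to the variables $(x,y,y',\dots,y^{(k)})$ satisfies $X^{(k)}(E)=0$ whenever $E=0$. The point symmetries form a real Lie algebra under the bracket of vector fields, called the symmetry algebra of the equation. The equation is considered where $y'\neq 0$. *)

(* Defs.v *)
From HB Require Import structures.
From mathcomp Require Import all_boot all_order all_algebra.
From mathcomp Require Import all_classical all_reals all_analysis.

Set Implicit Arguments.
Unset Strict Implicit.
Unset Printing Implicit Defensive.

Import Order.TTheory GRing.Theory Num.Theory.
Import numFieldNormedType.Exports.

Local Open Scope classical_set_scope.
Local Open Scope ring_scope.

Section LieAlgebras.
Context {R : realType}.

(* The bracket [br] is a total function on the ambient space [V]; only its
   values on [L] matter. *)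
Definition is_lie_algebra (V : lmodType R) (br : V -> V -> V) (L : set V) :
    Prop :=
  [/\ [/\ L 0,
          forall (c : R) (u v : V), L u -> L v -> L (c *: u + v)
        & forall u v : V, L u -> L v -> L (br u v)],
      forall (c : R) (u v w : V), L u -> L v -> L w ->
        br (c *: u + v) w = c *: br u w + br v w /\
        br w (c *: u + v) = c *: br w u + br w v,
      forall u : V, L u -> br u u = 0
    & forall u v w : V, L u -> L v -> L w ->
        br u (br v w) + br v (br w u) + br w (br u v) = 0].

Definition lie_isomorphic (V W : lmodType R)
    (brV : V -> V -> V) (L : set V) (brW : W -> W -> W) (M : set W) : Prop :=
  [/\ is_lie_algebra brV L, is_lie_algebra brW M
    & exists phi : V -> W,
        [/\ set_bij L M phi,
            forall (c : R) (u v : V), L u -> L v ->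
              phi (c *: u + v) = c *: phi u + phi v
          & forall u v : V, L u -> L v ->
              phi (brV u v) = brW (phi u) (phi v)]].

Definition sl2 : set 'M[R]_2 := [set A | \tr A = 0].

Definition mx_commutator (A B : 'M[R]_2) : 'M[R]_2 := A *m B - B *m A.

End LieAlgebras.

Section Calculus.
Context {R : realType}.

Definition pderiv (n : nat) (j : 'I_n.+1) (f : 'rV[R]_n.+1 -> R) :
    'rV[R]_n.+1 -> R :=
  fun p => 'D_(delta_mx 0 j) f p.

Fixpoint Ck_on (m n : nat) (U : set 'rV[R]_n.+1) (f : 'rV[R]_n.+1 -> R) :
    Prop :=
  (forall p, U p -> {for p, continuous f}) /\
  match m with
  | 0 => True
  | m'.+1 => forall j : 'I_n.+1,
      (forall p, U p -> derivable f p (delta_mx 0 j)) /\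
      Ck_on m' U (pderiv j f)
  end.

Definition smooth_on (n : nat) (U : set 'rV[R]_n.+1) (f : 'rV[R]_n.+1 -> R) :
    Prop :=
  forall m, Ck_on m U f.

(* A point of the plane is the row (x, y), and the field xi d/dx + eta d/dy is
   the map p |-> (xi p, eta p). *)
Definition vfield : Type := 'rV[R]_2 -> 'rV[R]_2.

Definition vcomp (X : vfield) (j : 'I_2) : 'rV[R]_2 -> R := fun p => X p 0 j.

(* A field on [U] is encoded by its extension by 0 to the whole plane, so that
   equality of fields on [U] is equality of functions.  As [U] is open, the
   extension does not affect derivatives at points of [U]. *)
Definition is_vfield_on (U : set 'rV[R]_2) (X : vfield) : Prop :=
  (forall j : 'I_2, smooth_on U (vcomp X j)) /\ (forall p, ~ U p -> X p = 0).

Definition vf_bracket (U : set 'rV[R]_2) (X Y : vfield) : vfield :=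
  fun p => if `[< U p >] then
    \row_(i < 2) \sum_(j < 2)
      (vcomp X j p * pderiv j (vcomp Y i) p -
       vcomp Y j p * pderiv j (vcomp X i) p)
  else 0.

End Calculus.

Arguments vfield R : clear implicits.

Section Jets.
Context {R : realType} (k : nat).

(* Coordinates (x, y, y', ..., y^(k)): x has index 0, y^(i) has index i + 1. *)
Definition jet : Type := 'rV[R]_(k.+2).

Definition ix : 'I_(k.+2) := ord0.
Definition iy (i : nat) : 'I_(k.+2) := inord i.+1.

(* y^(i), meaningful for i <= k *)
Definition jy (p : jet) (i : nat) : R := p 0 (iy i).

Definition jbase (p : jet) : 'rV[R]_2 := @lsubmx R 1 2 k p.

(* Truncated at order k: the total derivative of a function on jets that does
   not depend on y^(k). *)
Definition total_deriv (F : jet -> R) : jet -> R :=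
  fun p => pderiv ix F p + \sum_(i < k) jy p i.+1 * pderiv (iy i) F p.

Definition xi (X : vfield R) : jet -> R := fun p => vcomp X 0 (jbase p).
Definition eta (X : vfield R) : jet -> R := fun p => vcomp X 1 (jbase p).

(* Coefficient of d/dy^(i) in the prolongation of X; only used for i <= k, so
   that the truncation in [total_deriv] has no effect. *)
Fixpoint prolong_coef (X : vfield R) (i : nat) : jet -> R :=
  match i with
  | 0 => eta X
  | i'.+1 => fun p =>
      total_deriv (prolong_coef X i') p - jy p i'.+1 * total_deriv (xi X) p
  end.

Definition prolong (X : vfield R) (F : jet -> R) : jet -> R :=
  fun p => xi X p * pderiv ix F p +
           \sum_(i < k.+1) prolong_coef X i p * pderiv (iy i) F p.

Definition point_symmetries (Dom : set jet) (E : jet -> R)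
    (U : set 'rV[R]_2) : set (vfield R) :=
  [set X | is_vfield_on U X /\
           forall p : jet, U (jbase p) -> Dom p -> E p = 0 ->
             prolong X E p = 0].

End Jets.

Section Equation.
Context {R : realType}.

(* [fcoef k q] is f(k + 1 - q). *)
Definition fcoef (k q : nat) : R :=
  k%:R ^+ 2 + k%:R - 2 * k%:R * q%:R - q%:R + q%:R ^+ 2.

(* Only a 1, ..., a (k - 2) are constrained (and used). *)
Definition is_coef_system (k : nat) (a : nat -> R) : Prop :=
  [/\ 2 * a 1%N - fcoef k 1 = 0,
      forall q : nat, (2 <= q <= k - 3)%N ->
        2 * q%:R * a q + fcoef k q * a (q - 1)%N = 0
    & 2 * (k%:R - 1) * a (k - 2)%N + fcoef k (k - 2) * a (k - 3)%N = 0].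

Definition ode (k : nat) (a : nat -> R) : @jet R k -> R :=
  fun p => let y := jy p in
    y k
    - \sum_(1 <= q < k - 2)
        (a q * y 2 ^+ q * y (k - q)%N * y 1%N ^+ (k - 2 - q)) / y 1%N ^+ (k - 2)
    - (a (k - 2)%N * y 2 ^+ (k - 1)) / y 1%N ^+ (k - 2)
    + (y 0%N + (2 * y 1%N * y 3 - 3 * y 2 ^+ 2) / y 1%N ^+ 4) * y 1%N ^+ k.

Definition regular_jets (k : nat) : set (@jet R k) := [set p | jy p 1 != 0].

End Equation.

Arguments sl2 R : clear implicits.
Arguments jet R k : clear implicits.
Arguments ode {R} k a p.
Arguments regular_jets {R} k.

(* Main.v *)
(** The coefficient eta^(i) of the i-th prolongation of xi d/dx + eta d/dy is,
    for i >= 4, of the form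
      A_i y^(i) + (b - C(i+1,2) xi_y y'') y^(i-1) + (order <= i-2),
    with A_i = eta_y - i xi_x - (i+1) xi_y y' and b of order <= 1.  Solving the
    equation for y^(k) turns the symmetry condition into an identity in the
    remaining coordinates.  Comparing jets that differ only in y^(k-1) (and
    y^(k)) and extracting the coefficient of y'' y^(k-1) gives
      a_1 eta_x = k xi_y y'^2, hence eta_x = xi_y = 0.
    For such fields the coefficient of y^(k-1) at y'' = 0 gives eta_yy = 0 when
    k >= 5, and eta_yy = eta_y when k = 4 because the Schwarzian term then
    contains y^(k-1) = y'''.  The jets with y'' = ... = y^(k-1) = 0 give
      xi_xxx = 0,  (k-1) y eta_y + eta_{y^k} + eta + 2 eta_yyy = 0,
    and differentiating the latter in y yields eta = 0.  So xi is a quadratic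
    polynomial in x, globally because U is connected.  Conversely the recurrence
    defining the a_q makes the variation of the equation along such a field
    telescope to zero. *)

Require Import Defs.
From mathcomp Require Import all_boot all_order all_algebra.
From mathcomp Require Import all_classical all_reals all_analysis.
From mathcomp Require Import ring lra.
Import Order.TTheory GRing.Theory Num.Theory.
Import numFieldNormedType.Exports.
Set Implicit Arguments.
Unset Strict Implicit.
Unset Printing Implicit Defensive.
Local Open Scope classical_set_scope.
Local Open Scope ring_scope.

(** * First-order operators on jets *)

Section WeightedDerivative.
Context {R : realType} {n : nat}.
Implicit Types (w : 'I_n.+1 -> R) (p : 'rV[R]_n.+1) (F G : 'rV[R]_n.+1 -> R).

(** At a fixed jet both the total derivative and the prolongation are such combinations of partial
    derivatives, so one calculus with frozen weights serves both. *)
Definition wderiv w F p : R := \sum_j w j * pderiv j F p.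

(** Derivability is carried along with the value, because [derive] returns a junk value where the
    limit does not exist and the product and quotient rules need it. *)
Definition has_wderiv w p F (c : R) : Prop :=
  (forall j, derivable F p (delta_mx 0 j)) /\ wderiv w F p = c.

Lemma has_wderiv_eq w p F c d :
  has_wderiv w p F c -> c = d -> has_wderiv w p F d.
Proof. by move=> h <-. Qed.

(** Allows closed formulas that hold only locally: over the open set [U] for prolongation
    coefficients, and where y' is nonzero for the solved equation. *)
Lemma has_wderiv_near w p F G c : {near p, F =1 G} ->
  has_wderiv w p F c -> has_wderiv w p G c.
Proof.
move=> FG [dF <-]; have v0 j : delta_mx 0 j != 0 :> 'rV[R]_n.+1.
  by apply/eqP => /matrixP/(_ 0 j)/eqP; rewrite !mxE !eqxx oner_eq0.
split=> [j|]; first exact: near_eq_derivable (dF j).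
by apply: eq_bigr => j _; congr (_ * _); apply/esym/near_eq_derive.
Qed.

Lemma has_wderiv_cst w p (c : R) : has_wderiv w p (fun=> c) 0.
Proof.
split=> [j|]; first exact: derivable_cst.
by apply: big1 => j _; rewrite /pderiv derive_cst mulr0.
Qed.

Lemma has_wderivD w p F G c d : has_wderiv w p F c -> has_wderiv w p G d ->
  has_wderiv w p (fun q => F q + G q) (c + d).
Proof.
move=> [dF <-] [dG <-]; split=> [j|]; first exact: derivableD.
by rewrite -big_split; apply: eq_bigr => j _ /=; rewrite -mulrDr /pderiv -deriveD.
Qed.

Lemma has_wderivN w p F c : has_wderiv w p F c ->
  has_wderiv w p (fun q => - F q) (- c).
Proof.
move=> [dF <-]; split=> [j|]; first exact: derivableN.
by rewrite -sumrN; apply: eq_bigr => j _; rewrite -mulrN /pderiv -deriveN.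
Qed.

Lemma has_wderivB w p F G c d : has_wderiv w p F c -> has_wderiv w p G d ->
  has_wderiv w p (fun q => F q - G q) (c - d).
Proof. by move=> hF /has_wderivN; apply: has_wderivD. Qed.

Lemma has_wderivM w p F G c d : has_wderiv w p F c -> has_wderiv w p G d ->
  has_wderiv w p (fun q => F q * G q) (c * G p + F p * d).
Proof.
move=> [dF <-] [dG <-]; split=> [j|]; first exact: derivableM.
rewrite mulr_suml mulr_sumr -big_split; apply: eq_bigr => j _ /=.
rewrite /pderiv; have -> : 'D_(delta_mx 0 j) (fun q => F q * G q) p =
  F p *: 'D_(delta_mx 0 j) G p + G p *: 'D_(delta_mx 0 j) F p by exact: deriveM.
rewrite !/(_ *: _) /=; move: ('D__ _ _) ('D__ _ _) (F p) (G p) (w j).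
by move=> *; ring.
Qed.

(** At [m = 0] the junk exponent [m.-1] is harmless, its coefficient [m%:R] being 0. *)
Lemma has_wderivX w p F c m : has_wderiv w p F c ->
  has_wderiv w p (fun q => F q ^+ m) (m%:R * F p ^+ m.-1 * c).
Proof.
move=> hF; elim: m => [|m IH].
  by apply: has_wderiv_eq (has_wderiv_cst _ _ _) _; rewrite !mul0r.
have -> : (fun q => F q ^+ m.+1) = (fun q => F q * F q ^+ m).
  by apply/funext => q; rewrite exprS.
apply: has_wderiv_eq (has_wderivM hF IH) _.
case: m {IH} => [|m]; rewrite /= ?expr0 ?mul0r ?mulr0 ?mulr1 ?addr0 ?mul1r //.
by rewrite exprS -[m.+2]addn1 natrD; move: (F p) (F p ^+ m) m.+1%:R => *; ring.
Qed.

Lemma has_wderivV w p F c : F p != 0 -> has_wderiv w p F c ->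
  has_wderiv w p (fun q => (F q)^-1) (- (F p) ^- 2 * c).
Proof.
move=> F0 [dF <-]; split=> [j|]; first exact: derivableV.
rewrite mulr_sumr; apply: eq_bigr => j _; rewrite /pderiv deriveV//.
by rewrite /(_ *: _) /= mulrCA.
Qed.

Lemma has_wderiv_sum w p I (r : seq I) (P : pred I)
    (F : I -> 'rV[R]_n.+1 -> R) (c : I -> R) :
  (forall i, has_wderiv w p (F i) (c i)) ->
  has_wderiv w p (fun q => \sum_(i <- r | P i) F i q) (\sum_(i <- r | P i) c i).
Proof.
move=> h; elim: r => [|i r IH].
  rewrite big_nil; apply: (has_wderiv_near _ (has_wderiv_cst w p 0)).
  by near=> q; rewrite big_nil.
have E q : \sum_(j <- i :: r | P j) F j q =
    (if P i then F i q else 0) + \sum_(j <- r | P j) F j q.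
  by rewrite big_cons; case: ifP; rewrite // add0r.
have -> : (fun q => \sum_(j <- i :: r | P j) F j q) =
    (fun q => (if P i then F i q else 0) + \sum_(j <- r | P j) F j q).
  exact/funext.
have -> : \sum_(j <- i :: r | P j) c j =
    (if P i then c i else 0) + \sum_(j <- r | P j) c j.
  by rewrite big_cons; case: ifP; rewrite // add0r.
apply: has_wderivD IH; case: ifP => _; [exact: h | exact: has_wderiv_cst].
Unshelve. all: by end_near. Qed.

Lemma pderiv_coord p (i j : 'I_n.+1) :
  derivable (fun q : 'rV[R]_n.+1 => q 0 i) p (delta_mx 0 j) /\
  pderiv j (fun q : 'rV[R]_n.+1 => q 0 i) p = (i == j)%:R.
Proof.
have H : (fun h : R => h^-1 *: ((p + h *: delta_mx 0 j) 0 i - p 0 i)) @ 0^' -->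
    ((i == j)%:R : R).
  apply: cvg_near_cst; near=> h.
  rewrite !mxE eqxx /= addrC addKr /(_ *: _) /= mulrA mulVf ?mul1r//.
  near: h; exact: nbhs_dnbhs_neq.
have E : (fun h : R => h^-1 *: (((fun q : 'rV[R]_n.+1 => q 0 i) \o
    shift p) (h *: delta_mx 0 j) - p 0 i)) =
    (fun h : R => h^-1 *: ((p + h *: delta_mx 0 j) 0 i - p 0 i)).
  by apply/funext => h; rewrite [p + _]addrC.
split; first by rewrite /derivable E; apply/cvg_ex; eexists; exact: H.
by rewrite /pderiv /derive E; apply/cvg_lim: H.
Unshelve. all: by end_near. Qed.

Lemma has_wderiv_coord w p i : has_wderiv w p (fun q => q 0 i) (w i).
Proof.
split=> [j|]; first exact: (pderiv_coord _ _ _).1.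
rewrite /wderiv (bigD1 i)//= (pderiv_coord _ _ _).2 eqxx mulr1 big1 ?addr0//.
by move=> j ji; rewrite (pderiv_coord _ _ _).2 eq_sym (negPf ji) mulr0.
Qed.

End WeightedDerivative.

(** * Total derivative and prolongation as weighted sums of partial derivatives *)

Section JetCalculus.
Context {R : realType} {k : nat}.
Implicit Types (p q : jet R k) (F G : jet R k -> R) (f : 'rV[R]_2 -> R).

(** The weight 0 on d/dy^(k) is the truncation at order k. *)
Definition total_weight p (j : 'I_k.+2) : R :=
  if (j : nat) is i.+1 then if (i < k)%N then jy p i.+1 else 0 else 1.

Definition prolong_weight (X : vfield R) p (j : 'I_k.+2) : R :=
  if (j : nat) is i.+1 then prolong_coef X i p else xi X p.

Lemma lift0_iy (i : 'I_k.+1) : lift ord0 i = iy k i.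
Proof. by apply/val_inj; rewrite /= inordK // ltnS ltn_ord. Qed.

Lemma iyE i : (i <= k)%N -> iy k i = i.+1 :> nat.
Proof. by move=> ik; rewrite inordK. Qed.

Lemma total_weight_iy p i : (i < k)%N -> total_weight p (iy k i) = jy p i.+1.
Proof. by move=> ik; rewrite /total_weight iyE ?ik // ltnW. Qed.

Lemma prolong_weight_iy X p i :
  (i <= k)%N -> prolong_weight X p (iy k i) = prolong_coef X i p.
Proof. by move=> ik; rewrite /prolong_weight iyE. Qed.

Lemma total_derivE F p : total_deriv F p = wderiv (total_weight p) F p.
Proof.
rewrite /total_deriv /wderiv big_ord_recl /= mul1r; congr (_ + _).
rewrite big_ord_recr /=; set wk := total_weight p _.
have -> : wk = 0; last rewrite mul0r addr0.
  by rewrite /wk lift0_iy /total_weight iyE //= ltnn.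
by apply: eq_bigr => i _; rewrite lift0_iy total_weight_iy /= ?ltn_ord.
Qed.

Lemma prolongE X F p : prolong X F p = wderiv (prolong_weight X p) F p.
Proof.
rewrite /prolong /wderiv [RHS]big_ord_recl; congr (_ + _).
by apply: eq_bigr => i _; rewrite lift0_iy prolong_weight_iy // -ltnS.
Qed.

Lemma jbase_linear (h : R) p q : jbase (h *: p + q) = h *: jbase p + jbase q.
Proof. by apply/rowP => j; rewrite !mxE. Qed.

Lemma jbase_continuous : continuous (@jbase R k).
Proof.
move=> p; exact: (@continuous_lsubmx R 1 2 k p).
Qed.

Lemma jy0 p : jbase p 0 1 = jy p 0.
Proof.
rewrite /jbase mxE; congr (p 0 _); apply/val_inj; rewrite /= iyE //.
Qed.

Lemma jbase_iy i : (0 < i <= k)%N -> jbase (delta_mx 0 (iy k i) : jet R k) = 0.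
Proof.
move=> /andP[i0 ik]; apply/rowP => j; rewrite !mxE eqxx /=; case: eqP => // E.
have := congr1 val E; rewrite /= iyE // => Ej.
by have := ltn_ord j; rewrite Ej ltnS ltnS leqNgt i0.
Qed.

Lemma jbase_ix : jbase (delta_mx 0 (ix k) : jet R k) = delta_mx 0 0.
Proof. by apply/rowP => j; rewrite !mxE; congr (_ && _)%:R. Qed.

Lemma jbase_iy0 : jbase (delta_mx 0 (iy k 0) : jet R k) = delta_mx 0 1.
Proof.
apply/rowP => j; rewrite !mxE; congr (_ && _)%:R.
by rewrite -!val_eqE /= iyE.
Qed.

(** The projection [jbase] is linear, so the difference quotients along [v] upstairs and along
    [jbase v] downstairs are the same function of the increment. *)
Lemma derivable_jbase f p v : derivable f (jbase p) (jbase v) ->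
  derivable (f \o @jbase R k) p v /\
  'D_v (f \o @jbase R k) p = 'D_(jbase v) f (jbase p).
Proof.
have E : (fun h : R => h^-1 *: (((f \o @jbase R k) \o shift p) (h *: v) -
     (f \o @jbase R k) p)) =
  (fun h : R => h^-1 *: ((f \o shift (jbase p)) (h *: jbase v) - f (jbase p))).
  by apply/funext => h /=; rewrite jbase_linear.
by rewrite /derivable /derive E.
Qed.

(** Only the directions x and y contribute: [jbase] sends the unit vector of y^(i) to 0 for i >=
    1. *)
Lemma has_wderiv_base w p f : (forall j, derivable f (jbase p) (delta_mx 0 j)) ->
  has_wderiv w p (fun q => f (jbase q))
    (w (ix k) * pderiv 0 f (jbase p) + w (iy k 0) * pderiv 1 f (jbase p)).
Proof.
move=> df.
have dj j : derivable f (jbase p) (jbase (delta_mx 0 j : jet R k)).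
  case: (unliftP ord0 j) => [i ->|->]; last by rewrite jbase_ix.
  rewrite lift0_iy; case: (posnP i) => [->|i0]; first by rewrite jbase_iy0.
  have ik : (0 < i <= k)%N by rewrite i0 -ltnS ltn_ord.
  by rewrite jbase_iy //; exact: derivable0.
split=> [j|]; first exact: (derivable_jbase (dj j)).1.
have E j : pderiv j (fun q => f (jbase q)) p =
    'D_(jbase (delta_mx 0 j : jet R k)) f (jbase p).
  exact: (derivable_jbase (dj j)).2.
rewrite /wderiv big_ord_recl E jbase_ix; congr (_ + _).
rewrite big_ord_recl E lift0_iy jbase_iy0 big1 ?addr0// => i _.
by rewrite E lift0_iy jbase_iy ?derive0 ?mulr0//= -ltnS ltn_ord.
Qed.

Lemma has_wderiv_jy w p i : has_wderiv w p (fun q => jy q i) (w (iy k i)).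
Proof. exact: has_wderiv_coord. Qed.

End JetCalculus.

(** * Differential functions of bounded order and their total derivatives *)

Section DifferentialFunctions.
Context {R : realType} {k : nat} (U : set 'rV[R]_2).
Hypothesis Uopen : open U.
Implicit Types (p q : jet R k) (F G : jet R k -> R) (f : 'rV[R]_2 -> R).

(* The class in which remainders of the prolongation formulas are kept: closed
   under the total derivative (raising [n] by one), and its members depend on
   the jet coordinates up to y^(n) only. *)
Inductive order_le (n : nat) : (jet R k -> R) -> Prop :=
| order_le_base f : smooth_on U f -> order_le n (fun p => f (jbase p))
| order_le_cst c : order_le n (fun=> c)
| order_le_jy j : (j <= n)%N -> order_le n (fun p => jy p j)
| order_leD F G : order_le n F -> order_le n G ->
    order_le n (fun p => F p + G p)
| order_leM F G : order_le n F -> order_le n G ->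
    order_le n (fun p => F p * G p).

(** Remainders that vanish at jets with y'' = ... = y^(n) = 0, so that prolongation formulas can be
    evaluated there without knowing them explicitly. *)
Inductive jet_ideal (n : nat) : (jet R k -> R) -> Prop :=
| jet_ideal0 : jet_ideal n (fun=> 0)
| jet_ideal_jyM j F : (2 <= j <= n)%N -> order_le n F ->
    jet_ideal n (fun p => jy p j * F p)
| jet_idealD F G : jet_ideal n F -> jet_ideal n G ->
    jet_ideal n (fun p => F p + G p).

Definition has_total_deriv F G : Prop :=
  forall p, U (jbase p) -> has_wderiv (total_weight p) p F (G p).

Lemma order_leB n F G : order_le n F -> order_le n G ->
  order_le n (fun p => F p - G p).
Proof.
move=> hF hG; have -> : (fun p => F p - G p) = (fun p => F p + (fun=> -1) p * G p).
  by apply/funext => p; rewrite mulN1r.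
by apply: order_leD => //; apply: order_leM => //; apply: order_le_cst.
Qed.

Lemma order_leX n F m : order_le n F -> order_le n (fun p => F p ^+ m).
Proof.
move=> hF; elim: m => [|m IH]; first exact: order_le_cst.
have -> : (fun p => F p ^+ m.+1) = (fun p => F p * F p ^+ m).
  by apply/funext => p; rewrite exprS.
exact: order_leM.
Qed.

Lemma order_leW m n F : (m <= n)%N -> order_le m F -> order_le n F.
Proof.
move=> mn; elim=> [f|c|j jm|{}F G _ ? _ ?|{}F G _ ? _ ?].
- exact: order_le_base.
- exact: order_le_cst.
- by apply: order_le_jy; apply: leq_trans mn.
- exact: order_leD.
- exact: order_leM.
Qed.

Lemma smooth_on_derivable f b j : smooth_on U f -> U b ->
  derivable f b (delta_mx 0 j).
Proof. by move=> sf Ub; case: (sf 1%N) => _ /(_ j)[+ _]; apply. Qed.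

Lemma smooth_on_pderiv f j : smooth_on U f -> smooth_on U (pderiv j f).
Proof. by move=> sf m; case: (sf m.+1) => _ /(_ j)[]. Qed.

Lemma order_le_depends n F p q : order_le n F -> jbase p = jbase q ->
  (forall j, (j <= n)%N -> jy p j = jy q j) -> F p = F q.
Proof.
move=> hF pq jpq; elim: hF => [f _|//|j jn|{}F G _ -> _ ->|{}F G _ -> _ ->] //.
- by rewrite pq.
- exact: jpq.
Qed.

Lemma jet_ideal_eq0 n F p : jet_ideal n F ->
  (forall j, (2 <= j <= n)%N -> jy p j = 0) -> F p = 0.
Proof.
move=> hF p0; elim: hF => [//|j {}F jn _|{}F G _ -> _ ->]; last by rewrite addr0.
by rewrite p0 ?mul0r.
Qed.

Lemma has_total_deriv_cst c : has_total_deriv (fun=> c) (fun=> 0).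
Proof. by move=> p _; apply: has_wderiv_cst. Qed.

Lemma has_total_deriv_base f : (0 < k)%N -> smooth_on U f ->
  has_total_deriv (fun p => f (jbase p))
    (fun p => pderiv 0 f (jbase p) + jy p 1 * pderiv 1 f (jbase p)).
Proof.
move=> k0 sf p Up; apply: has_wderiv_eq (has_wderiv_base _ _) _ => [j|].
  exact: smooth_on_derivable.
by rewrite total_weight_iy // mul1r.
Qed.

Lemma has_total_deriv_jy i : (i < k)%N ->
  has_total_deriv (fun p => jy p i) (fun p => jy p i.+1).
Proof.
by move=> ik p Up; rewrite -total_weight_iy //; apply: has_wderiv_jy.
Qed.

Lemma has_total_derivD F G F' G' :
  has_total_deriv F F' -> has_total_deriv G G' ->
  has_total_deriv (fun p => F p + G p) (fun p => F' p + G' p).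
Proof. by move=> h1 h2 p Up; apply: has_wderivD; [exact: h1|exact: h2]. Qed.

Lemma has_total_derivB F G F' G' :
  has_total_deriv F F' -> has_total_deriv G G' ->
  has_total_deriv (fun p => F p - G p) (fun p => F' p - G' p).
Proof. by move=> h1 h2 p Up; apply: has_wderivB; [exact: h1|exact: h2]. Qed.

Lemma has_total_derivM F G F' G' :
  has_total_deriv F F' -> has_total_deriv G G' ->
  has_total_deriv (fun p => F p * G p) (fun p => F' p * G p + F p * G' p).
Proof. by move=> h1 h2 p Up; apply: has_wderivM; [exact: h1|exact: h2]. Qed.

Lemma has_total_derivX F F' n :
  has_total_deriv F F' ->
  has_total_deriv (fun p => F p ^+ n) (fun p => n%:R * F p ^+ n.-1 * F' p).
Proof. by move=> h p Up; apply: has_wderivX; exact: h. Qed.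

Lemma has_total_deriv_eq F G G' : has_total_deriv F G ->
  (forall p, U (jbase p) -> G p = G' p) -> has_total_deriv F G'.
Proof. by move=> h E p Up; rewrite -E //; apply: h. Qed.

(** By the Leibniz rule the new coordinate y^(n+1) enters only through the derivative of y^(n),
    hence to the first power and with a coefficient of order n. *)
Lemma order_le_total_deriv n F : (n < k)%N -> order_le n F ->
  exists F' F'', [/\ order_le n F', order_le n F'' &
    has_total_deriv F (fun p => jy p n.+1 * F' p + F'' p)].
Proof.
move=> nk; elim=> [f sf|c|j jn|{}F G hF IHF hG IHG|{}F G hF IHF hG IHG].
- have hD := has_total_deriv_base (leq_ltn_trans (leq0n _) nk) sf.
  have h0 := order_le_base n (smooth_on_pderiv 0 sf).
  have h1 := order_le_base n (smooth_on_pderiv 1 sf).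
  (* At order 0 the coordinate y' is the new one, so the y-derivative becomes the leading
     coefficient; at higher order it belongs to the remainder. *)
  case: (posnP n) => [n0|n0].
    exists (fun p => pderiv 1 f (jbase p)), (fun p => pderiv 0 f (jbase p)).
    by split=> //; apply: has_total_deriv_eq hD _ => p _; rewrite n0 addrC.
  exists (fun=> 0), (fun p => pderiv 0 f (jbase p) + jy p 1 * pderiv 1 f (jbase p)).
  split; first exact: order_le_cst.
    by apply: order_leD => //; apply: order_leM => //; apply: order_le_jy.
  by apply: has_total_deriv_eq hD _ => p _; rewrite mulr0 add0r.
- exists (fun=> 0), (fun=> 0); split; try exact: order_le_cst.
  by apply: has_total_deriv_eq (has_total_deriv_cst c) _ => p _; rewrite mulr0 addr0.
- have hD := has_total_deriv_jy (leq_ltn_trans jn nk).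
  case: (ltngtP j n) jn => // [jn _|jn _].
    exists (fun=> 0), (fun p => jy p j.+1); split.
    + exact: order_le_cst.
    + exact: order_le_jy.
    + by apply: has_total_deriv_eq hD _ => p _; rewrite mulr0 add0r.
  exists (fun=> 1), (fun=> 0); split; try exact: order_le_cst.
  by apply: has_total_deriv_eq hD _ => p _; rewrite mulr1 addr0 jn.
- have [F1 [F2 [hF1 hF2 hD]]] := IHF; have [G1 [G2 [hG1 hG2 hE]]] := IHG.
  exists (fun p => F1 p + G1 p), (fun p => F2 p + G2 p).
  split; try exact: order_leD.
  by apply: has_total_deriv_eq (has_total_derivD hD hE) _ => p _; rewrite mulrDr addrACA.
- have [F1 [F2 [hF1 hF2 hD]]] := IHF; have [G1 [G2 [hG1 hG2 hE]]] := IHG.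
  exists (fun p => F1 p * G p + F p * G1 p), (fun p => F2 p * G p + F p * G2 p).
  split; try by apply: order_leD; exact: order_leM.
  apply: has_total_deriv_eq (has_total_derivM hD hE) _ => p _.
  move: (F p) (G p) (F1 p) (F2 p) (G1 p) (G2 p) (jy p n.+1) => *; ring.
Qed.

Lemma order_le_total_derivW n F : (n < k)%N -> order_le n F ->
  exists2 F', order_le n.+1 F' & has_total_deriv F F'.
Proof.
move=> nk hF; have [F' [F'' [h' h'' hD]]] := order_le_total_deriv nk hF.
eexists; last exact: hD.
apply: order_leD; last exact: order_leW h''.
by apply: order_leM; [exact: order_le_jy|exact: order_leW h'].
Qed.

(** A generator y^(j) F has derivative y^(j+1) F + y^(j) DF, again a sum of multiples of coordinates
    between y'' and y^(n+1). *)
Lemma jet_ideal_total_deriv n F : (n < k)%N -> jet_ideal n F ->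
  exists2 F', jet_ideal n.+1 F' & has_total_deriv F F'.
Proof.
move=> nk; elim=> [|j {}F /andP[j2 jn] hF|{}F G _ [F' hF hD] _ [G' hG hE]].
- by exists (fun=> 0); [exact: jet_ideal0|exact: has_total_deriv_cst].
- have [F' hF' hD] := order_le_total_derivW nk hF.
  eexists; last exact: has_total_derivM (has_total_deriv_jy (leq_ltn_trans jn nk)) hD.
  apply: jet_idealD; apply: jet_ideal_jyM => //.
  + by rewrite ltnW //= ltnS.
  + exact: order_leW hF.
  + by rewrite j2 leqW.
- by eexists; [exact: jet_idealD hF hG|exact: has_total_derivD].
Qed.

Lemma near_region p : U (jbase p) -> \forall q \near p, U (jbase q).
Proof.
by move=> Up; apply: (@jbase_continuous R k p U); apply: open_nbhs_nbhs.
Qed.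

(** One step of the prolongation recursion starting from a formula known only over [U]; openness
    makes it valid near [p], which is all that derivatives see. *)
Lemma prolong_coefS X i F F' : (0 < k)%N -> smooth_on U (vcomp X 0) ->
  (forall p, U (jbase p) -> prolong_coef X i p = F p) -> has_total_deriv F F' ->
  forall p, U (jbase p) -> prolong_coef X i.+1 p = F' p - jy p i.+1 *
    (pderiv 0 (vcomp X 0) (jbase p) + jy p 1 * pderiv 1 (vcomp X 0) (jbase p)).
Proof.
move=> k0 sX E hD p Up; rewrite /= !total_derivE.
have [_ ->] := has_total_deriv_base k0 sX Up.
have : {near p, F =1 prolong_coef X i}.
  by near=> q; rewrite E//; near: q; exact: near_region.
by move=> /has_wderiv_near/(_ (hD p Up))[_ ->].
Unshelve. all: by end_near. Qed.

End DifferentialFunctions.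

(** * Functions with vanishing partial derivatives *)

Section VanishingPartials.
Context {R : realType} (U : set 'rV[R]_2).
Hypothesis Uopen : open U.
Implicit Types (p q : 'rV[R]_2) (f : 'rV[R]_2 -> R) (i j : 'I_2).

Local Notation e_ i := (delta_mx 0 i : 'rV[R]_2).

Lemma is_derive_line f q i (t : R) : derivable f (t *: e_ i + q) (e_ i) ->
  is_derive t (1 : R) (fun s : R => f (s *: e_ i + q)) (pderiv i f (t *: e_ i + q)).
Proof.
have E : (fun h : R => h^-1 *: (((fun s : R => f (s *: e_ i + q)) \o shift t) (h *: 1)
      - f (t *: e_ i + q))) =
    (fun h : R => h^-1 *: ((f \o shift (t *: e_ i + q)) (h *: e_ i)
      - f (t *: e_ i + q))).
  apply/funext => h /=; congr (_ *: (f _ - _)).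
  by rewrite [h *: 1]mulr1 scalerDl addrA.
move=> df; apply: DeriveDef; last by rewrite /pderiv /derive E.
by rewrite /derivable E.
Qed.

Lemma cst_segment f q i (h : R) : 0 <= h ->
  (forall t, 0 <= t <= h -> derivable f (t *: e_ i + q) (e_ i)) ->
  (forall t, 0 <= t <= h -> pderiv i f (t *: e_ i + q) = 0) ->
  f (h *: e_ i + q) = f q.
Proof.
move=> h0 df f0; pose g := fun s : R => f (s *: e_ i + q).
have dg t : t \in `[0, h] -> is_derive t (1 : R) g 0.
  rewrite in_itv /= => th; have := is_derive_line (df t th).
  by rewrite f0.
have dg' t : t \in `]0, h[ -> is_derive t (1 : R) g 0.
  by move=> th; apply: dg; apply: subset_itv_oo_cc th.
have cg : {within `[0, h], continuous g}.
  by apply: derivable_within_continuous => x /dg[].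
have [c _] := @MVT_segment R g (fun=> 0) 0 h h0 dg' cg.
by rewrite mul0r /g scale0r add0r => /eqP; rewrite subr_eq0 => /eqP.
Qed.

Lemma ord2_cases i : i = 0 \/ i = 1.
Proof.
by case: (unliftP 0 i) => [l|] ->; [right; rewrite (ord1 l); exact/val_inj|left].
Qed.

Lemma ballP p q (r : R) :
  ball p r q <-> 0 < r /\ forall i, `|p 0 i - q 0 i| < r.
Proof.
split=> [[r0 H]|[r0 H]]; split=> //; first by move=> i; exact: H.
by move=> i j; rewrite (ord1 i); exact: H.
Qed.

(** Balls of the sup norm are boxes, so they contain the axis-parallel segments between their
    points. *)
Lemma ball_segment p q (r t h : R) i : 0 <= t <= h ->
  ball p r q -> ball p r (h *: e_ i + q) -> ball p r (t *: e_ i + q).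
Proof.
move=> /andP[t0 th] /ballP[r0 H1] /ballP[_ H2]; apply/ballP; split=> // j.
move: (H1 j) (H2 j); rewrite !mxE /=; case: eqP => _; last by rewrite !mulr0 !add0r.
by rewrite !mulr1 !ltr_norml => /andP[? ?] /andP[? ?]; apply/andP; split; lra.
Qed.

Lemma locally_cst f i p : (forall q, U q -> derivable f q (e_ i)) ->
  (forall q, U q -> pderiv i f q = 0) -> U p ->
  exists2 r : R, 0 < r & ball p r `<=` U /\
    forall q h, ball p r q -> ball p r (h *: e_ i + q) -> f (h *: e_ i + q) = f q.
Proof.
move=> df f0 Up; have /nbhs_ballP[r /= r0 rU] : nbhs p U by apply: open_nbhs_nbhs.
exists r => //; split=> // q h bq bhq.
(* A negative increment is a positive one run backwards from the other endpoint. *)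
have seg h' q' : 0 <= h' -> ball p r q' -> ball p r (h' *: e_ i + q') ->
    f (h' *: e_ i + q') = f q'.
  by move=> h'0 b1 b2; apply: cst_segment => // t th; [apply: df|apply: f0];
    apply: rU; apply: ball_segment th b1 b2.
have [h0|/ltW h0] := leP 0 h; first exact: seg.
have E : - h *: e_ i + (h *: e_ i + q) = q by rewrite addrA -scalerDl addNr scale0r add0r.
by have := seg (- h) (h *: e_ i + q); rewrite E oppr_ge0 => ->.
Qed.

(* No symmetry of second partials is needed: [f] is locally constant in the
   direction [i], hence so is [pderiv j f]. *)
Lemma pderiv_pderiv_eq0 f i j : (forall q, U q -> derivable f q (e_ i)) ->
  (forall q, U q -> pderiv i f q = 0) ->
  forall p, U p -> pderiv i (pderiv j f) p = 0.
Proof.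
move=> df f0 p Up; have [r r0 [rU cst]] := locally_cst df f0 Up.
have H h : `|h| < r -> pderiv j f (h *: e_ i + p) = pderiv j f p.
  move=> hr; have bp : ball p r (h *: e_ i + p).
    apply/ballP; split=> // l; rewrite !mxE /= opprD addrCA addrN addr0.
    by rewrite normrN normrM; case: eqP => _; rewrite ?normr1 ?mulr1 ?normr0 ?mulr0.
  have -> : pderiv j f (h *: e_ i + p) = pderiv j (fun x => f (h *: e_ i + x)) p.
    rewrite /pderiv /derive; apply: (congr1 (fun g : R -> R => lim (g @ 0^'))).
    apply/funext => t /=.
    by rewrite addrCA.
  apply: near_eq_derive; near=> x; apply: cst.
    by near: x; apply: nbhsx_ballx.
  near: x.
  have ct : {for p, continuous (fun x : 'rV[R]_2 => h *: e_ i + x)}.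
    by apply: continuousD; [exact: cst_continuous|exact: id].
  by apply: ct; apply: open_nbhs_nbhs; split => //; exact: ball_open.
rewrite {1}/pderiv /derive; apply/cvg_lim => //; apply: cvg_near_cst; near=> h.
rewrite /= H ?subrr ?scaler0 //.
by near: h; apply: dnbhs0_lt.
Unshelve. all: by end_near. Qed.

(** Inside a box any point is reached from the centre by two axis-parallel segments, so [f] is
    locally constant; its level sets in [U] are then relatively open and closed. *)
Lemma connected_cst f : connected U ->
  (forall i q, U q -> derivable f q (e_ i)) ->
  (forall i q, U q -> pderiv i f q = 0) ->
  forall p q, U p -> U q -> f p = f q.
Proof.
move=> Uc df f0 p q Up Uq.
have loc x : U x -> exists2 r : R, 0 < r &
    ball x r `<=` U /\ forall y : 'rV[R]_2, ball x r y -> f y = f x.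
  move=> Ux.
  have [r r0 [rU c0]] := locally_cst (df 0) (f0 0) Ux.
  have [s s0 [sU c1]] := locally_cst (df 1) (f0 1) Ux.
  exists (Num.min r s); first by rewrite lt_min r0.
  split=> [y|y /ballP[_ H]].
    by move/(le_ball _) => by_; apply: rU; apply: by_; rewrite ge_min lexx.
  have {}H i : `|x 0 i - y 0 i| < r /\ `|x 0 i - y 0 i| < s.
    by apply/andP; rewrite -lt_min.
  (* [z] is the corner of the path, with the first coordinate of [y] and the second of [x]. *)
  pose z := (y 0 0 - x 0 0) *: e_ 0 + x.
  have zE : z = y - (y 0 1 - x 0 1) *: e_ 1.
    apply/rowP => i; rewrite !mxE.
    have [->|->] := ord2_cases i.
    - have E (a b c d : R) : (a - b) * 1 + b = a - (c - d) * 0 by ring.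
      exact: E.
    - have E (a b c d : R) : (c - d) * 0 + b = a - (a - b) * 1 by ring.
      exact: E.
  have bz : forall t, (forall i, `|x 0 i - y 0 i| < t) -> 0 < t -> ball x t z.
    move=> t Ht t0; apply/ballP; split=> // i; rewrite !mxE.
    have [->|->] := ord2_cases i; rewrite /= ?mulr1 ?mulr0 ?add0r ?subrr ?normr0 //.
    by rewrite subrK.
  have yE : y = (y 0 1 - x 0 1) *: e_ 1 + z by rewrite zE addrC subrK.
  rewrite yE c1 ?c0 //.
  + exact: ballxx.
  + by apply: bz => // i; case: (H i).
  + by apply: bz => // i; case: (H i).
  + by rewrite -yE; apply/ballP; split=> // i; case: (H i).
pose B := [set x | U x /\ f x = f p].
suff BU : B = U by have [_ ->] : B q by rewrite BU.
apply: Uc; first by exists p.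
- exists B; last by apply/seteqP; split=> x [].
  rewrite openE => x [Ux fx]; have [r r0 [rU c]] := loc x Ux.
  by apply/nbhs_ballP; exists r => //= y xy; split; [exact: rU|rewrite c].
- exists (~` [set x | U x /\ f x <> f p]); last first.
    apply/seteqP; split=> x [Ux].
      by move=> fx; split=> // -[_].
    by move=> /not_andP[//|/contrapT].
  apply: open_closedC; rewrite openE => x [Ux fx]; have [r r0 [rU c]] := loc x Ux.
  by apply/nbhs_ballP; exists r => //= y xy; split; [exact: rU|rewrite c].
Qed.

Lemma pderiv_zero_on f (b : 'rV[R]_2) j : (forall q, U q -> f q = 0) -> U b ->
  pderiv j f b = 0.
Proof.
move=> f0 Ub; rewrite /pderiv -[RHS](derive_cst (0 : R) b (delta_mx 0 j)).
apply: near_eq_derive; near=> q; rewrite f0 //; near: q; exact: open_nbhs_nbhs.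
Unshelve. all: by end_near. Qed.

Lemma has_wderiv_smooth f w (b : 'rV[R]_2) : smooth_on U f -> U b ->
  has_wderiv w b f (w 0 * pderiv 0 f b + w 1 * pderiv 1 f b).
Proof.
move=> sf Ub; split=> [j|]; first exact: smooth_on_derivable sf Ub.
rewrite /wderiv big_ord_recl big_ord1.
by have -> : lift ord0 ord0 = 1 :> 'I_2 by exact/val_inj.
Qed.

Lemma connected_cst_wderiv f : connected U ->
  (forall w b, U b -> has_wderiv w b f 0) ->
  forall b b', U b -> U b' -> f b = f b'.
Proof.
move=> Uc f0; apply: connected_cst => // i b Ub.
  by case: (f0 (fun=> 0) b Ub).
have [_ <-] := f0 (fun j => (j == i)%:R) b Ub.
rewrite /wderiv (bigD1 i) //= eqxx mul1r big1 ?addr0 // => j /negPf ->.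
by rewrite mul0r.
Qed.

End VanishingPartials.

(** * Structure of the prolongation coefficients *)

(* [ring] and [field] are very slow unless the atoms are made variables. *)
Ltac jet_atoms :=
  cbv beta;
  repeat match goal with
  | |- context [jy ?p ?i] => generalize (jy p i); intro
  | |- context [?f (jbase ?p)] => generalize (f (jbase p)); intro
  | |- context [?F ?p] => is_var F; is_var p;
      match type of p with jet _ _ => generalize (F p); intro end
  end.

Ltac jet_ring := jet_atoms; ring.

Ltac total_deriv_with base_tac :=
  lazymatch goal with
  | |- has_total_deriv _ (fun p => jy p _) _ => by apply: has_total_deriv_jy
  | |- has_total_deriv _ (fun p => @?F p - @?G p) _ =>
      apply: (@has_total_derivB _ _ _ F G); total_deriv_with base_tac
  | |- has_total_deriv _ (fun p => @?F p + @?G p) _ =>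
      apply: (@has_total_derivD _ _ _ F G); total_deriv_with base_tac
  | |- has_total_deriv _ (fun p => @?F p * @?G p) _ =>
      apply: (@has_total_derivM _ _ _ F G); total_deriv_with base_tac
  | |- has_total_deriv _ (fun p => @?F p ^+ ?n) _ =>
      apply: (@has_total_derivX _ _ _ F _ n); total_deriv_with base_tac
  | H : has_total_deriv _ ?F _ |- has_total_deriv _ (fun p => ?F p) _ => exact: H
  | |- has_total_deriv _ (fun p => ?f (jbase p)) _ => base_tac
  | |- _ => exact: has_total_deriv_cst
  end.

Ltac total_deriv_tac := total_deriv_with ltac:(
  apply: has_total_deriv_base => //; by repeat apply: smooth_on_pderiv).

Ltac order_with base_tac :=
  lazymatch goal with
  | |- order_le _ _ (fun p => jy p _) => by apply: order_le_jy
  | |- order_le _ _ (fun p => @?F p - @?G p) =>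
      apply: (@order_leB _ _ _ _ F G); order_with base_tac
  | |- order_le _ _ (fun p => @?F p + @?G p) =>
      apply: (@order_leD _ _ _ _ F G); order_with base_tac
  | |- order_le _ _ (fun p => @?F p * @?G p) =>
      apply: (@order_leM _ _ _ _ F G); order_with base_tac
  | |- order_le _ _ (fun p => @?F p ^+ ?n) =>
      apply: (@order_leX _ _ _ _ F n); order_with base_tac
  | H : order_le _ ?n ?F |- order_le _ ?n (fun p => ?F p) => exact: H
  | H : order_le _ ?m ?F |- order_le _ ?n (fun p => ?F p) =>
      by apply: (@order_leW _ _ _ m n _ _ H)
  | |- order_le _ _ (fun p => ?f (jbase p)) => apply: order_le_base; base_tac
  | |- _ => exact: order_le_cst
  end.

Ltac order_tac := order_with ltac:(by repeat apply: smooth_on_pderiv).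

Section ProlongationStructure.
Context {R : realType} {k : nat} (U : set 'rV[R]_2) (X : vfield R).
Hypotheses (Uopen : open U) (k4 : (4 <= k)%N).
Hypothesis smoothX : forall j, smooth_on U (vcomp X j).
Implicit Types p q : jet R k.

Local Notation xi_x p := (pderiv 0 (vcomp X 0) (jbase p)).
Local Notation xi_y p := (pderiv 1 (vcomp X 0) (jbase p)).
Local Notation eta_x p := (pderiv 0 (vcomp X 1) (jbase p)).
Local Notation eta_y p := (pderiv 1 (vcomp X 1) (jbase p)).

(** The factor A_i multiplying y^(i) in the i-th prolongation coefficient, for i >= 2. *)
Definition prolong_lead (i : nat) p : R :=
  eta_y p - i%:R * xi_x p - i.+1%:R * xi_y p * jy p 1.

Lemma prolong_leadS i p :
  prolong_lead i.+1 p = prolong_lead i p - (xi_x p + jy p 1 * xi_y p).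
Proof. by rewrite /prolong_lead; jet_ring. Qed.

Lemma order_le_prolong_lead i : order_le U 1 (prolong_lead i).
Proof. rewrite /prolong_lead; order_tac. Qed.

Let k_gt0 : (0 < k)%N. Proof. exact: leq_trans k4. Qed.
Let k_gt1 : (1 < k)%N. Proof. exact: leq_trans k4. Qed.
Let k_gt2 : (2 < k)%N. Proof. exact: leq_trans k4. Qed.

(** The coordinate y'' can only come from differentiating the factor y' of the last term. *)
Lemma prolong_lead_total_deriv i : exists2 a, order_le U 1 a &
  has_total_deriv U (prolong_lead i)
    (fun p => a p - i.+1%:R * xi_y p * jy p 2).
Proof.
exists (fun p => pderiv 0 (pderiv 1 (vcomp X 1)) (jbase p)
   + jy p 1 * pderiv 1 (pderiv 1 (vcomp X 1)) (jbase p)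
   - i%:R * (pderiv 0 (pderiv 0 (vcomp X 0)) (jbase p)
      + jy p 1 * pderiv 1 (pderiv 0 (vcomp X 0)) (jbase p))
   - i.+1%:R * (pderiv 0 (pderiv 1 (vcomp X 0)) (jbase p)
      + jy p 1 * pderiv 1 (pderiv 1 (vcomp X 0)) (jbase p)) * jy p 1).
  order_tac.
apply: has_total_deriv_eq; first by rewrite /prolong_lead; total_deriv_tac.
by move=> p Up /=; jet_ring.
Qed.

Lemma prolong_coef_step i F F' G :
  (forall p, U (jbase p) -> prolong_coef X i p = F p) ->
  has_total_deriv U F F' ->
  (forall p, U (jbase p) -> F' p - jy p i.+1 * (xi_x p + jy p 1 * xi_y p) = G p) ->
  forall p, U (jbase p) -> prolong_coef X i.+1 p = G p.
Proof.
by move=> E hD H p Up; rewrite (prolong_coefS Uopen k_gt0 (smoothX 0) E hD) ?H.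
Qed.

Lemma prolong_coef0 p : prolong_coef X 0 p = vcomp X 1 (jbase p).
Proof. by []. Qed.

Lemma prolong_coef1 p : U (jbase p) -> prolong_coef X 1 p =
  eta_x p + jy p 1 * eta_y p - jy p 1 * (xi_x p + jy p 1 * xi_y p).
Proof.
have hD := has_total_deriv_base k_gt0 (smoothX 1).
by move=> Up; rewrite (prolong_coefS Uopen k_gt0 (smoothX 0) (fun p _ => prolong_coef0 p) hD).
Qed.

Lemma prolong_coef2 : exists2 g, order_le U 1 g & forall p, U (jbase p) ->
  prolong_coef X 2 p = prolong_lead 2 p * jy p 2 + g p.
Proof.
pose D f p := pderiv 0 f (jbase p) + jy p 1 * pderiv 1 f (jbase p).
exists (fun p => D (pderiv 0 (vcomp X 1)) p + jy p 1 * D (pderiv 1 (vcomp X 1)) p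
  - jy p 1 * (D (pderiv 0 (vcomp X 0)) p + jy p 1 * D (pderiv 1 (vcomp X 0)) p)).
  rewrite /D; order_tac.
apply: (prolong_coef_step prolong_coef1); first by total_deriv_tac.
move=> p Up.
by rewrite /D /prolong_lead; jet_ring.
Qed.

(** Order 3 is kept apart: there y'' y^(i-1) is the square of y'', with coefficient -3 xi_y, while
    the general pattern would give -6 xi_y. *)
Lemma prolong_coef3 : exists h' h'', [/\ order_le U 1 h', order_le U 1 h'' &
  forall p, U (jbase p) -> prolong_coef X 3 p =
    prolong_lead 3 p * jy p 3 - 3 * xi_y p * jy p 2 ^+ 2 + jy p 2 * h' p + h'' p].
Proof.
have [g og Eg] := prolong_coef2.
have [a oa ha] := prolong_lead_total_deriv 2.
have [g' [g'' [og' og'' hg]]] := order_le_total_deriv k_gt1 og.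
exists (fun p => a p + g' p), g''; split=> //; first by order_tac.
apply: (prolong_coef_step Eg); first by total_deriv_tac.
move=> p Up.
by rewrite prolong_leadS; jet_ring.
Qed.

(** Passing from i to i+1, the derivative of A_i adds -(i+1) xi_y to the coefficient of y'' y^(i),
    and Pascal's rule sums these. The start is -10 xi_y at order 4: -6 from differentiating the
    square of y'' and -4 from A_3. *)
Lemma prolong_coef_structure i : (i.+4 <= k)%N ->
  exists b C, [/\ order_le U 1 b, order_le U i.+2 C & forall p, U (jbase p) ->
    prolong_coef X i.+4 p = prolong_lead i.+4 p * jy p i.+4 +
      (b p - 'C(i.+4.+1, 2)%:R * xi_y p * jy p 2) * jy p i.+3 + C p].
Proof.
elim: i => [_|i IH ik].
  have [h' [h'' [oh' oh'' E]]] := prolong_coef3.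
  have [a oa ha] := prolong_lead_total_deriv 3.
  have [e oe he] := order_le_total_derivW k_gt1 oh'.
  have [f of_ hf] := order_le_total_derivW k_gt1 oh''.
  exists (fun p => a p + h' p), (fun p => jy p 2 * e p + f p -
    3 * (pderiv 0 (pderiv 1 (vcomp X 0)) (jbase p) +
      jy p 1 * pderiv 1 (pderiv 1 (vcomp X 0)) (jbase p)) * jy p 2 ^+ 2).
  split; [order_tac|order_tac|].
  apply: (prolong_coef_step E); first by total_deriv_tac.
move=> p Up.
  by rewrite prolong_leadS (_ : 'C(5, 2) = 10%N) //=; jet_ring.
have [b [C [ob oC E]]] := IH (ltnW ik).
have [a oa ha] := prolong_lead_total_deriv i.+4.
have [b' ob' hb] := order_le_total_derivW k_gt1 ob.
have [C' oC' hC] := order_le_total_derivW (leq_trans (leqnSn _) (ltnW ik)) oC.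
have lt4 : (i.+4 < k)%N by [].
have lt3 : (i.+3 < k)%N by exact: ltnW.
exists (fun p => a p + b p), (fun p => (b' p - 'C(i.+4.+1, 2)%:R *
    ((pderiv 0 (pderiv 1 (vcomp X 0)) (jbase p) +
      jy p 1 * pderiv 1 (pderiv 1 (vcomp X 0)) (jbase p)) * jy p 2 +
      xi_y p * jy p 3)) * jy p i.+3 + C' p).
split; [order_tac|order_tac|].
apply: (prolong_coef_step E); first by total_deriv_tac.
move=> p Up.
have EB : 'C(i.+4.+2, 2)%:R = 'C(i.+4.+1, 2)%:R + i.+4.+1%:R :> R.
  by rewrite -natrD binS bin1.
rewrite (prolong_leadS i.+4) EB; move: ('C(_, _)%:R) => B.
by jet_ring.
Qed.

Lemma prolong_coef_leading i : (1 < i <= k)%N -> exists2 C, order_le U i.-1 C &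
  forall p, U (jbase p) -> prolong_coef X i p = prolong_lead i p * jy p i + C p.
Proof.
case: i => [|[|[|[|i]]]] // /andP[_ ik].
- exact: prolong_coef2.
- have [h' [h'' [oh' oh'' E]]] := prolong_coef3.
  exists (fun p => jy p 2 * h' p + h'' p - 3 * xi_y p * jy p 2 ^+ 2).
    order_tac.
  by move=> p Up; rewrite E //; jet_ring.
- have [b [C [ob oC E]]] := prolong_coef_structure ik.
  exists (fun p => (b p - 'C(i.+4.+1, 2)%:R * xi_y p * jy p 2) * jy p i.+3 + C p).
    order_tac.
  by move=> p Up; rewrite E //; jet_ring.
Qed.

Lemma order_le_prolong_coef i : (i <= k)%N -> exists2 C, order_le U i C &
  forall p, U (jbase p) -> prolong_coef X i p = C p.
Proof.
case: i => [_|[_|i ik]].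
- by exists (fun p => vcomp X 1 (jbase p)) => //; apply: order_le_base.
- eexists; last by move=> p Up; exact: prolong_coef1.
  order_tac.
- have [C oC E] := @prolong_coef_leading i.+2 ik.
  exists (fun p => prolong_lead i.+2 p * jy p i.+2 + C p) => //.
  have := order_le_prolong_lead i.+2 => oA; order_tac.
Qed.

End ProlongationStructure.

(** * Prolongation of fields with eta_x = 0 and xi_y = 0 *)

Section SeparatedProlongation.
Context {R : realType} {k : nat} (U : set 'rV[R]_2) (X : vfield R).
Hypotheses (Uopen : open U) (k4 : (4 <= k)%N).
Hypothesis smoothX : forall j, smooth_on U (vcomp X j).
Hypothesis eta_x0 : forall b, U b -> pderiv 0 (vcomp X 1) b = 0.
Hypothesis xi_y0 : forall b, U b -> pderiv 1 (vcomp X 0) b = 0.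
Implicit Types p q : jet R k.

Local Notation xi_ m := (iter m (pderiv 0) (vcomp X 0)).
Local Notation eta_ m := (iter m (pderiv 1) (vcomp X 1)).

Lemma smooth_xi m : smooth_on U (xi_ m).
Proof. by elim: m => [|m IH]; [exact: smoothX|exact: smooth_on_pderiv]. Qed.

Lemma smooth_eta m : smooth_on U (eta_ m).
Proof. by elim: m => [|m IH]; [exact: smoothX|exact: smooth_on_pderiv]. Qed.

Lemma eta_pderiv0 m b : U b -> pderiv 0 (eta_ m) b = 0.
Proof.
elim: m b => [|m IH] b Ub; first exact: eta_x0.
apply: (pderiv_pderiv_eq0 Uopen) => // q Uq.
exact: smooth_on_derivable (smooth_eta m) Uq.
Qed.

Lemma xi_pderiv1 m b : U b -> pderiv 1 (xi_ m) b = 0.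
Proof.
elim: m b => [|m IH] b Ub; first exact: xi_y0.
apply: (pderiv_pderiv_eq0 Uopen) => // q Uq.
exact: smooth_on_derivable (smooth_xi m) Uq.
Qed.

Let k_gt0 : (0 < k)%N. Proof. exact: leq_trans k4. Qed.
Let k_gt1 : (1 < k)%N. Proof. exact: leq_trans k4. Qed.
Let k_gt2 : (2 < k)%N. Proof. exact: leq_trans k4. Qed.

Lemma xi_total_deriv m : has_total_deriv U (fun p : jet R k => xi_ m (jbase p))
  (fun p => xi_ m.+1 (jbase p)).
Proof.
apply: has_total_deriv_eq (has_total_deriv_base k_gt0 (smooth_xi m)) _ => p Up.
by rewrite (xi_pderiv1 m Up) mulr0 addr0.
Qed.

Lemma eta_total_deriv m : has_total_deriv U (fun p : jet R k => eta_ m (jbase p))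
  (fun p => jy p 1 * eta_ m.+1 (jbase p)).
Proof.
apply: has_total_deriv_eq (has_total_deriv_base k_gt0 (smooth_eta m)) _ => p Up.
by rewrite (eta_pderiv0 m Up) add0r.
Qed.

Ltac exact_total_deriv H :=
  let T := type of H in
  lazymatch T with has_total_deriv _ ?F _ =>
  lazymatch goal with |- has_total_deriv _ F _ => exact: H end end.

(* [idtac;] keeps the match from being evaluated when the tactic is passed. *)
Ltac separated_tac := total_deriv_with ltac:(
  idtac; lazymatch goal with
  | |- has_total_deriv _ (fun p => iter ?m _ _ (jbase p)) _ =>
      first [exact_total_deriv (xi_total_deriv m)
           | exact_total_deriv (eta_total_deriv m)]
  end).

Lemma separated_step i F F' G :
  (forall p, U (jbase p) -> prolong_coef X i p = F p) ->
  has_total_deriv U F F' ->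
  (forall p, U (jbase p) -> F' p - jy p i.+1 * xi_ 1 (jbase p) = G p) ->
  forall p, U (jbase p) -> prolong_coef X i.+1 p = G p.
Proof.
move=> E hD H; apply: (prolong_coef_step Uopen k4 smoothX E hD) => p Up.
by rewrite (xi_y0 Up) mulr0 addr0 H.
Qed.

Lemma separated_prolong0 p : prolong_coef X 0 p = eta_ 0 (jbase p).
Proof. by []. Qed.

Lemma separated_prolong1 p : U (jbase p) ->
  prolong_coef X 1 p = (eta_ 1 (jbase p) - xi_ 1 (jbase p)) * jy p 1.
Proof.
move: p; apply: (separated_step (fun p _ => separated_prolong0 p) (eta_total_deriv 0)).
by move=> p Up; jet_ring.
Qed.

Lemma separated_prolong2 p : U (jbase p) -> prolong_coef X 2 p =
  (eta_ 1 (jbase p) - 2 * xi_ 1 (jbase p)) * jy p 2 +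
  (eta_ 2 (jbase p) * jy p 1 - xi_ 2 (jbase p)) * jy p 1.
Proof.
move: p; apply: (separated_step separated_prolong1).
  separated_tac.
by move=> p Up; jet_ring.
Qed.

(** At order m = i+3 the explicit terms are those in y^(m) and y^(m-1) needed later and those left
    when y'', ..., y^(m) vanish; every other term is a multiple of one of y'', ..., y^(m-2). *)
Lemma separated_prolong i : (i.+3 <= k)%N ->
  exists2 S, jet_ideal U i.+1 S & forall p, U (jbase p) ->
    prolong_coef X i.+3 p =
    (eta_ 1 (jbase p) - i.+3%:R * xi_ 1 (jbase p)) * jy p i.+3 +
    (i.+3%:R * eta_ 2 (jbase p) * jy p 1
      - 'C(i.+3, 2)%:R * xi_ 2 (jbase p)) * jy p i.+2 +
    eta_ i.+3 (jbase p) * jy p 1 ^+ i.+3 - xi_ i.+3 (jbase p) * jy p 1 + S p.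
Proof.
elim: i => [_|i IH ik].
  exists (fun=> 0); first exact: jet_ideal0.
  apply: (separated_step separated_prolong2).
    separated_tac.
  by move=> p Up; rewrite (_ : 'C(3, 2) = 3%N) //=; jet_ring.
have [S hS E] := IH (ltnW ik).
have [S' hS' hD] := jet_ideal_total_deriv (ltn_trans (ltnSn _) (ltnW ik)) hS.
have k2 : (i.+2 < k)%N by exact: ltnW.
(* At the next order y^(i+2) itself falls into the ideal and takes the derivative of its coefficient
   along; the y'' term comes from differentiating the powers of y'. *)
exists (fun p => jy p i.+2 * (i.+3%:R * eta_ 3 (jbase p) * jy p 1 ^+ 2
      + i.+3%:R * eta_ 2 (jbase p) * jy p 2 - 'C(i.+3, 2)%:R * xi_ 3 (jbase p))
    + jy p 2 * (i.+3%:R * eta_ i.+3 (jbase p) * jy p 1 ^+ i.+2 - xi_ i.+3 (jbase p))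
    + S' p).
  apply: jet_idealD hS'; apply: jet_idealD; apply: jet_ideal_jyM;
    rewrite ?leqnn //;
    order_with ltac:(first [exact: smooth_eta|exact: smooth_xi]).
apply: (separated_step E).
  separated_tac.
move=> p Up.
have EB : 'C(i.+4, 2)%:R = 'C(i.+3, 2)%:R + i.+3%:R :> R by rewrite -natrD binS bin1.
rewrite EB; move: ('C(i.+3, 2)%:R) => B.
have EX (t : R) m : t ^+ m.+1 = t * t ^+ m by rewrite exprS.
rewrite !(EX _ i.+3) !(EX _ i.+2) [i.+3.-1]/=.
move: (jy p 1 ^+ i.+2) => T.
jet_ring.
Qed.

End SeparatedProlongation.

(** * The prolonged equation *)

Section ProlongedEquation.
Context {R : realType} (n : nat) (a : nat -> R).
Local Notation k := n.+4.
Implicit Types (p q : jet R k) (y e : nat -> R).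

(* The equation solved for y^(k); the last term of the sum, [q = k - 2], is the
   monomial (y'')^(k-1) / (y')^(k-2). *)
Definition ode_rhs y : R :=
  \sum_(1 <= q < n.+3) a q * ((y 2 / y 1) ^+ q * y (k - q)%N) -
  y 0 * y 1 ^+ k - (2 * y 1 ^+ n.+1 * y 3 - 3 * y 2 ^+ 2 * y 1 ^+ n).

(** First variation of y''/y' along y^(i) |-> e i. *)
Definition ratio_variation y e : R := (e 2 * y 1 - y 2 * e 1) / y 1 ^+ 2.

(* First variation of [ode_rhs] along y^(i) |-> e i; at [n = 0] the junk power
   [n.-1] has coefficient 0. *)
Definition ode_rhs_variation y e : R :=
  \sum_(1 <= q < n.+3) a q *
    (q%:R * (y 2 / y 1) ^+ q.-1 * ratio_variation y e * y (k - q)%N +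
     (y 2 / y 1) ^+ q * e (k - q)%N) -
  (e 0 * y 1 ^+ k + y 0 * (k%:R * y 1 ^+ n.+3 * e 1)) -
  (2 * (n.+1%:R * y 1 ^+ n * e 1 * y 3 + y 1 ^+ n.+1 * e 3) -
   3 * (2 * y 2 * e 2 * y 1 ^+ n + y 2 ^+ 2 * (n%:R * y 1 ^+ n.-1 * e 1))).

(** The quotient y'^(k-2-q) / y'^(k-2) is y'^(-q), which makes each term a power of y''/y' times
    y^(k-q). At q = k-2 the factor y^(k-q) is y'', and the separate last term of the equation
    appears. *)
Lemma odeE p : jy p 1 != 0 -> ode k a p = jy p k - ode_rhs (jy p).
Proof.
move=> y1; rewrite /ode /ode_rhs [in RHS]big_nat_recr //= !subSS subn0.
have -> : \sum_(1 <= i < n.+2) a i * ((jy p 2 / jy p 1) ^+ i * jy p (k - i)) =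
  \sum_(1 <= i < n.+2) a i * jy p 2 ^+ i * jy p (k - i) * jy p 1 ^+ (n.+2 - i) /
     jy p 1 ^+ n.+2.
  rewrite big_nat [RHS]big_nat; apply: eq_bigr => i /andP[_ i2].
  have i2' : (i <= n.+2)%N by exact: ltnW.
  have -> : jy p 1 ^+ n.+2 = jy p 1 ^+ (n.+2 - i) * jy p 1 ^+ i.
    by rewrite -exprD subnK.
  rewrite exprMn exprVn.
  have y1X : jy p 1 ^+ (n.+2 - i) != 0 by rewrite expf_neq0.
  have y1X' : jy p 1 ^+ i != 0 by rewrite expf_neq0.
  move: (jy p 1 ^+ (n.+2 - i)) (jy p 1 ^+ i) (jy p 2 ^+ i) (jy p (k - i)) (a i) y1X y1X'.
  by move=> s t v w z s0 t0; field; rewrite s0 t0.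
rewrite (_ : (n.+2 - n = 2)%N); last by rewrite -addn2 addKn.
set S := \sum_(_ <= _ < _) _.
have E4 : jy p 1 ^+ k = jy p 1 ^+ 4 * jy p 1 ^+ n by rewrite -exprD.
have E2 : jy p 1 ^+ n.+2 = jy p 1 ^+ 2 * jy p 1 ^+ n by rewrite -exprD.
have E1 : jy p 1 ^+ n.+1 = jy p 1 * jy p 1 ^+ n by rewrite exprS.
rewrite exprMn exprVn !E4 !E2 E1 [jy p 2 ^+ n.+3]exprS.
have y1X : jy p 1 ^+ n != 0 by rewrite expf_neq0.
move: (jy p 1 ^+ n) (jy p 2 ^+ n.+2) (a n.+2) S y1X y1.
move: (jy p 0) (jy p 1) (jy p 2) (jy p 3) (jy p k) => y0 y1 y2 y3 yk t s an S t0 y10.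
by field; rewrite t0 y10.
Qed.

Lemma near_jy_neq0 p i : jy p i != 0 -> \forall q \near p, jy q i != 0.
Proof.
have c := @coord_continuous R 1 k.+2 0 (iy k i) p.
move=> yi; exact: (cvgr_neq0 _ c yi).
Qed.

Lemma prolong_ode X p : jy p 1 != 0 ->
  prolong X (ode k a) p =
  prolong_coef X k p - ode_rhs_variation (jy p) (fun i => prolong_coef X i p).
Proof.
move=> y1; rewrite prolongE; set w := prolong_weight X p.
have hjy i : (i <= k)%N -> has_wderiv w p (fun q => jy q i) (prolong_coef X i p).
  by move=> ik; rewrite -prolong_weight_iy //; apply: has_wderiv_jy.
suff : has_wderiv w p (ode k a) (prolong_coef X k p -
    ode_rhs_variation (jy p) (fun i => prolong_coef X i p)) by case.
apply: (@has_wderiv_near _ _ _ _ (fun q => jy q k - ode_rhs (jy q))).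
  by near=> q; rewrite odeE//; near: q; exact: near_jy_neq0.
apply: has_wderivB; first exact: hjy.
have hu : has_wderiv w p (fun q => jy q 2 / jy q 1)
    (ratio_variation (jy p) (fun i => prolong_coef X i p)).
  apply: has_wderiv_eq (has_wderivM (hjy 2%N _) (has_wderivV y1 (hjy 1%N _))) _ => //.
  rewrite /ratio_variation; move: (jy p 1) (jy p 2) y1 => t s t0.
  by move: (prolong_coef X 1 p) (prolong_coef X 2 p) => *; field.
apply: has_wderivB; first apply: has_wderivB.
- apply: has_wderiv_sum => i.
  apply: has_wderiv_eq (has_wderivM (has_wderiv_cst _ _ _)
    (has_wderivM (has_wderivX _ hu) (hjy (k - i)%N _))) _; first exact: leq_subr.
  by rewrite mul0r add0r.
- apply: has_wderivM; first exact: hjy.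
  exact: has_wderivX (hjy 1%N _).
- apply: has_wderiv_eq.
    apply: has_wderivB.
      apply: has_wderivM (hjy 3%N _) => //.
      apply: has_wderivM (has_wderiv_cst _ _ _) (has_wderivX _ (hjy 1%N _)) => //.
    apply: has_wderivM (has_wderivX _ (hjy 1%N _)) => //.
    apply: has_wderivM (has_wderiv_cst _ _ _) (has_wderivX _ (hjy 2%N _)) => //.
  rewrite [n.+1.-1]/= [2.-1]/= expr1.
  move: (jy p 1 ^+ n.+1) (jy p 1 ^+ n.-1) (jy p 1 ^+ n) => A B C.
  move: (jy p 1) (jy p 2) (jy p 3) (prolong_coef X 1 p) (prolong_coef X 2 p)
    (prolong_coef X 3 p) => *; ring.
Unshelve. all: by end_near. Qed.

End ProlongedEquation.

(** * Symmetries are projective vector fields *)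

Section ShellJets.
Context {R : realType} (n : nat) (a : nat -> R).
Local Notation k := n.+4.
Implicit Types (p q : jet R k) (b : 'rV[R]_2).

Lemma eq_ode_rhs (y z : nat -> R) :
  (forall i, (i < k)%N -> y i = z i) -> ode_rhs n a y = ode_rhs n a z.
Proof.
move=> E; rewrite /ode_rhs !E //; congr (_ - _ - _).
rewrite big_nat [RHS]big_nat; apply: eq_bigr => i /andP[i1 i2].
by rewrite !E // -subn_gt0 subKn // ltnW // ltnW.
Qed.

(** The coordinates x and y come from [b]; the sequence supplies y', y'' and so on. *)
Definition mk_jet b (y : nat -> R) : jet R k :=
  \row_j (if (j : nat) is i.+1 then if i == 0%N then b 0 1 else y i else b 0 0).

Lemma jbase_mk_jet b y : jbase (mk_jet b y) = b.
Proof. by apply/rowP => j; rewrite !mxE; have [->|->] := ord2_cases j. Qed.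

Lemma jy_mk_jet b y i : (0 < i <= k)%N -> jy (mk_jet b y) i = y i.
Proof. by case/andP; case: i => // i _ ik; rewrite /jy mxE iyE. Qed.

(** [ode_rhs] does not involve y^(k), so the lower coordinates can be prescribed freely and y^(k)
    solved for. *)
Lemma shell_jet b (y : nat -> R) : exists p, [/\ jbase p = b,
  forall i, (0 < i < k)%N -> jy p i = y i & jy p k = ode_rhs n a (jy p)].
Proof.
pose z i := if i == k then ode_rhs n a (jy (mk_jet b y)) else y i.
have E i : (0 < i < k)%N -> jy (mk_jet b z) i = y i.
  move=> /andP[i0 ik]; rewrite jy_mk_jet ?i0 1?ltnW // /z.
  by rewrite (ltn_eqF ik).
exists (mk_jet b z); split=> //; first exact: jbase_mk_jet.
have zk : z k = ode_rhs n a (jy (mk_jet b y)) by rewrite /z eqxx.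
rewrite jy_mk_jet ?leqnn // zk; apply: eq_ode_rhs => -[|i] ik.
  by rewrite -!jy0 !jbase_mk_jet.
by rewrite E ?ik // jy_mk_jet //= (ltnW ik).
Qed.

End ShellJets.

(** * Comparison of two jets that agree up to order k-2 *)

Section TopCoefficient.
Context {R : realType} (n : nat) (a : nat -> R) (U : set 'rV[R]_2) (X : vfield R).
Local Notation k := n.+4.
Hypothesis Uopen : open U.
Hypothesis smoothX : forall j, smooth_on U (vcomp X j).
Variables p p' : jet R k.
Hypotheses (Up : U (jbase p)) (pp' : jbase p = jbase p').
Hypothesis low : forall i, (i <= n.+2)%N -> jy p i = jy p' i.
Hypothesis top : jy p n.+3 = jy p' n.+3 + 1.

Let k4 : (4 <= k)%N. Proof. by []. Qed.
Let Up' : U (jbase p'). Proof. by rewrite -pp'. Qed.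

Lemma prolong_coef_low i : (i <= n.+2)%N -> prolong_coef X i p = prolong_coef X i p'.
Proof.
move=> i2; have ik : (i <= k)%N := leq_trans i2 (leqW (leqnSn _)).
have [C oC E] := order_le_prolong_coef Uopen k4 smoothX ik.
rewrite !E //; apply: order_le_depends oC pp' _ => j ji.
by apply: low; apply: leq_trans i2.
Qed.

Lemma prolong_lead_low i : prolong_lead X i p = prolong_lead X i p'.
Proof.
apply: order_le_depends (order_le_prolong_lead smoothX i) pp' _ => j j1.
by apply: low; apply: leq_trans j1 _.
Qed.

(** The coefficient of order k-1 is affine in y^(k-1) with slope [prolong_lead], and the two jets
    differ by 1 in that coordinate. *)
Lemma prolong_coef_top :
  prolong_coef X n.+3 p = prolong_coef X n.+3 p' + prolong_lead X n.+3 p'.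
Proof.
have [|C oC E] := prolong_coef_leading Uopen k4 smoothX (i := n.+3).
  by rewrite /= leqnSn.
rewrite !E // top prolong_lead_low (order_le_depends oC pp') //.
by rewrite mulrDr mulr1 addrAC.
Qed.

(* When [k = 4] the Schwarzian term contains y''' = y^(k-1); this is what the
   factor [(n == 0)%:R] records here and below. *)
Lemma low3 : jy p 3 = jy p' 3 + (n == 0%N)%:R.
Proof.
have top' m : m = n -> jy p m.+3 = jy p' m.+3 + 1 by move=> ->; exact: top.
by case: posnP => [/esym/top' //|n0]; rewrite low // addr0.
Qed.

Lemma prolong_coef_low3 :
  prolong_coef X 3 p = prolong_coef X 3 p' + (n == 0%N)%:R * prolong_lead X 3 p'.
Proof.
have top' m : m = n ->
    prolong_coef X m.+3 p = prolong_coef X m.+3 p' + prolong_lead X m.+3 p'.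
  by move=> ->; exact: prolong_coef_top.
case: posnP => [/esym/top'|n0]; first by rewrite mul1r.
by rewrite mul0r addr0 prolong_coef_low.
Qed.

(** Within the sum only the term q = 1 contains y^(k-1); the Schwarzian part contributes when k =
    4. *)
Lemma ode_rhs_top : ode_rhs n a (jy p) = ode_rhs n a (jy p') +
  a 1 * (jy p' 2 / jy p' 1) - (n == 0%N)%:R * (2 * jy p' 1 ^+ n.+1).
Proof.
rewrite /ode_rhs big_ltn // [in RHS]big_ltn // !expr1 subn1 /= top low3 !low //.
have -> : \sum_(2 <= i < n.+3) a i * ((jy p' 2 / jy p' 1) ^+ i * jy p (k - i)) =
  \sum_(2 <= i < n.+3) a i * ((jy p' 2 / jy p' 1) ^+ i * jy p' (k - i)).
  rewrite big_nat [RHS]big_nat; apply: eq_bigr => i /andP[i1 _].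
  by rewrite low // (leq_sub2l k i1).
set S := \sum_(_ <= _ < _) _; move: S (jy p' 1 ^+ n.+1) (jy p' 1 ^+ n) (jy p' 1 ^+ k) (_ / _).
move: (n == 0%N)%:R (jy p' n.+3) (jy p' 0) (jy p' 2) (jy p' 3) => *.
ring.
Qed.

Lemma ode_rhs_variation_top :
  ode_rhs_variation n a (jy p) (fun i => prolong_coef X i p) =
  ode_rhs_variation n a (jy p') (fun i => prolong_coef X i p') +
  a 1 * (ratio_variation (jy p') (fun i => prolong_coef X i p') +
         jy p' 2 / jy p' 1 * prolong_lead X n.+3 p') -
  (n == 0%N)%:R * (2 * (n.+1%:R * jy p' 1 ^+ n * prolong_coef X 1 p' +
                       jy p' 1 ^+ n.+1 * prolong_lead X 3 p')).
Proof.
have D : ratio_variation (jy p) (fun i => prolong_coef X i p) =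
    ratio_variation (jy p') (fun i => prolong_coef X i p').
  by rewrite /ratio_variation !low // !prolong_coef_low.
rewrite /ode_rhs_variation D big_ltn // [in RHS]big_ltn // !expr1 expr0 subn1 [k.-1]/=.
rewrite prolong_coef_top top prolong_coef_low3 low3 !low //.
rewrite (@prolong_coef_low 0) // (@prolong_coef_low 1) // (@prolong_coef_low 2) //.
set V := ratio_variation _ _; set u := jy p' 2 / jy p' 1.
have -> : \sum_(2 <= i < n.+3) a i * (i%:R * u ^+ i.-1 * V * jy p (k - i) +
     u ^+ i * prolong_coef X (k - i) p) =
  \sum_(2 <= i < n.+3) a i * (i%:R * u ^+ i.-1 * V * jy p' (k - i) +
     u ^+ i * prolong_coef X (k - i) p').
  rewrite big_nat [RHS]big_nat; apply: eq_bigr => i /andP[i1 _].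
  by rewrite low ?prolong_coef_low // (leq_sub2l k i1).
set S := \sum_(_ <= _ < _) _; move: S => S.
move: (jy p' 1 ^+ n.+1) (jy p' 1 ^+ n.-1) (jy p' 1 ^+ n.+3) (jy p' 1 ^+ n) (jy p' 1 ^+ k).
move: (prolong_lead X n.+3 p') (prolong_lead X 3 p') (prolong_coef X n.+3 p').
move: (prolong_coef X 0 p') (prolong_coef X 1 p') (prolong_coef X 2 p') (prolong_coef X 3 p').
move: V u; move: (n == 0%N)%:R (jy p' n.+3) (jy p' 0) (jy p' 2) (jy p' 3) => *.
ring.
Qed.

End TopCoefficient.

(** * The determining equations and their solution *)

Section Necessity.
Context {R : realType} (n : nat) (a : nat -> R) (U : set 'rV[R]_2) (X : vfield R).
Local Notation k := n.+4.
Hypothesis Uopen : open U.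
Hypothesis a_system : is_coef_system k a.
Hypothesis smoothX : forall j, smooth_on U (vcomp X j).
Hypothesis symX : forall p : jet R k, U (jbase p) -> jy p 1 != 0 ->
  ode k a p = 0 -> prolong X (ode k a) p = 0.
Implicit Types (p : jet R k) (b q : 'rV[R]_2) (f : 'rV[R]_2 -> R).

Let k4 : (4 <= k)%N. Proof. by []. Qed.

Lemma natr_bin2 m : 'C(m.+1, 2)%:R = m.+1%:R * m%:R / 2 :> R.
Proof.
have /(congr1 (fun i => i%:R : R)) := bin_ffact m.+1 2.
by rewrite ffactnS ffactn1 !natrM => <-; rewrite mulfK // pnatr_eq0.
Qed.

Lemma coef1E : a 1 = k%:R * (k%:R - 1) / 2.
Proof.
case: a_system => /eqP; rewrite subr_eq0 /fcoef => /eqP E _ _.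
apply: (@mulfI _ 2); first by rewrite pnatr_eq0.
by rewrite E; move: (k%:R) => K; field.
Qed.

Lemma shell_prolong p : U (jbase p) -> jy p 1 != 0 ->
  jy p k = ode_rhs n a (jy p) ->
  prolong_coef X k p = ode_rhs_variation n a (jy p) (fun i => prolong_coef X i p).
Proof.
move=> Up y1 E; apply/eqP; rewrite -subr_eq0 -prolong_ode // symX //.
by rewrite odeE // E subrr.
Qed.

(** Both jets lie on the equation, with y^(k-1) equal to 1 and 0. Subtracting their symmetry
    conditions leaves only the contributions of y^(k-1) and y^(k). *)
Lemma shell_difference b (t s : R) : U b -> t != 0 ->
  exists p p', [/\ jbase p = b /\ jbase p' = b,
    [/\ jy p' 1 = t, jy p' 2 = s & forall i, (2 < i < k)%N -> jy p' i = 0],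
    (forall i, (i <= n.+2)%N -> jy p i = jy p' i) /\ jy p n.+3 = jy p' n.+3 + 1,
    jy p k = jy p' k + a 1 * (s / t) - (n == 0%N)%:R * (2 * t ^+ n.+1) &
    prolong_coef X k p = prolong_coef X k p' +
      a 1 * (ratio_variation (jy p') (fun i => prolong_coef X i p') +
             s / t * prolong_lead X n.+3 p') -
      (n == 0%N)%:R * (2 * (n.+1%:R * t ^+ n * prolong_coef X 1 p' +
                       t ^+ n.+1 * prolong_lead X 3 p'))].
Proof.
move=> Ub t0.
pose z w i := if i == 1%N then t else if i == 2%N then s else if i == n.+3 then w else 0.
have [p [pb py pk]] := shell_jet n a b (z 1).
have [p' [pb' py' pk']] := shell_jet n a b (z 0).
have low i : (i <= n.+2)%N -> jy p i = jy p' i.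
  move=> i2; case: (posnP i) => [->|i0]; first by rewrite -!jy0 pb pb'.
  have ik : (i < k)%N by rewrite ltnS ltnW.
  by rewrite py ?py' ?i0 // /z; case: eqP => // _; case: eqP => // _; rewrite ltn_eqF.
have top : jy p n.+3 = jy p' n.+3 + 1.
  by rewrite py ?py' ?ltnSn // /z eqxx /= add0r.
have y1 : jy p' 1 = t by rewrite py'.
have y2 : jy p' 2 = s by rewrite py'.
have pp' : jbase p = jbase p' by rewrite pb pb'.
have Up : U (jbase p) by rewrite pb.
exists p, p'; split=> //.
- split=> // -[|[|[|i]]] // ik; rewrite py' // /z /=; by case: ifP.
- by rewrite pk pk' (ode_rhs_top a low top) y1 y2.
- have p1 : jy p 1 != 0 by rewrite low // y1.
  have p1' : jy p' 1 != 0 by rewrite y1.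
  have Up' : U (jbase p') by rewrite pb'.
  rewrite (shell_prolong Up p1 pk) (shell_prolong Up' p1' pk').
  by rewrite (ode_rhs_variation_top a Uopen smoothX Up pp' low top) y1 y2.
Qed.

(* [p1, p1'] have y'' = 1 and [p0, p0'] have y'' = 0, so subtracting the two
   instances of [shell_difference] isolates the coefficient of y'' y^(k-1). *)
Lemma eta_x_xi_y_relation b (t : R) : U b -> t != 0 ->
  a 1 * pderiv 0 (vcomp X 1) b = k%:R * pderiv 1 (vcomp X 0) b * t ^+ 2.
Proof.
move=> Ub t0.
have [B [C [oB oC Ek]]] := prolong_coef_structure Uopen k4 smoothX (leqnn k).
have [g og E2] := prolong_coef2 Uopen k4 smoothX.
have [p1 [p1' [[pb1 pb1'] [y1 y2 y3] [low top] dk dP]]] := shell_difference 1 Ub t0.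
have [p0 [p0' [[qb1 qb1'] [z1 z2 z3] [lowz topz] dkz dPz]]] := shell_difference 0 Ub t0.
have low1 j : (j <= 1)%N -> jy p1' j = jy p0' j.
  by case: j => [|[|]] //; rewrite ?y1 ?z1 // -!jy0 pb1' qb1'.
have same F : order_le U 1 F -> [/\ F p1 = F p0', F p1' = F p0' & F p0 = F p0'].
  move=> oF.
  have E1 : F p1' = F p0' by apply: (order_le_depends oF) => //; rewrite pb1' qb1'.
  split=> //; first rewrite -E1.
    apply: (order_le_depends oF); first by rewrite pb1 pb1'.
    by move=> j j1; apply: low; apply: leq_trans j1 _.
  apply: (order_le_depends oF); first by rewrite qb1 qb1'.
  by move=> j j1; apply: lowz; apply: leq_trans j1 _.
have oA i : order_le U 1 (fun p : jet R k => prolong_lead X i p).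
  exact: order_le_prolong_lead.
have oC' : C p1 = C p1' /\ C p0 = C p0'.
  by split; apply: (order_le_depends oC); rewrite ?pb1 ?pb1' ?qb1 ?qb1'.
move: dP dPz; rewrite !Ek ?pb1 ?pb1' ?qb1 ?qb1' //.
rewrite dk dkz top topz oC'.1 oC'.2 (low 2%N) // (lowz 2%N) // y2 z2.
rewrite /ratio_variation !E2 ?pb1 ?pb1' ?qb1 ?qb1' //.
rewrite !(prolong_coef1 Uopen k4 smoothX) ?pb1 ?pb1' ?qb1 ?qb1' // y1 y2 z1 z2.
have [-> -> ->] := same _ oB; have [_ -> _] := same _ og.
have [-> -> ->] := same _ (oA k).
have [_ -> _] := same _ (oA 2).
have [_ -> _] := same _ (oA 3).
have [_ -> _] := same _ (oA n.+3).
rewrite /prolong_lead z1 qb1' natr_bin2.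
rewrite coef1E.
move: (pderiv 0 (vcomp X 0) b) (pderiv 1 (vcomp X 0) b).
move: (pderiv 0 (vcomp X 1) b) (pderiv 1 (vcomp X 1) b).
move: ((n == 0%N)%:R : R) => d ex ey xx xy.
move: (t ^+ n.+1) (t ^+ n) (B p0') (g p0') (C p0') (C p1') (jy p0' k) (jy p1' k)
  (jy p0' n.+3) (jy p1' n.+3).
have [N4 N3] : n.+4.+1%:R = k%:R + 1 :> R /\ n.+3%:R = k%:R - 1 :> R.
  by split; [rewrite natr1|apply/eqP; rewrite eq_sym subr_eq natr1].
rewrite N4 N3; move: (k%:R : R) (n.+1%:R : R) => K N.
move=> T T0 B0 g0 C0 C1 w0 w1 v0 v1 /eqP; rewrite -subr_eq0 => /eqP e1.
move=> /eqP; rewrite -subr_eq0 => /eqP e0.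
(* The factor [t ^+ 2] clears the denominators coming from [s / t] and from [ratio_variation]. *)
have := congr2 (fun u v => (u - v) * t ^+ 2) e1 e0; cbv beta.
rewrite [RHS](_ : _ = 0) => [E|]; last by rewrite subrr mul0r.
by apply/eqP; rewrite -subr_eq0 -E; apply/eqP; field.
Qed.

(** One side of the relation does not depend on t, so t = 1 and t = 2 give 3 k xi_y = 0; then eta_x
    = 0 because a_1 = k(k-1)/2 is nonzero. *)
Lemma eta_x_xi_y_eq0 b : U b ->
  pderiv 0 (vcomp X 1) b = 0 /\ pderiv 1 (vcomp X 0) b = 0.
Proof.
move=> Ub; have := eta_x_xi_y_relation Ub (oner_neq0 R).
have two0 : 2 != 0 :> R by rewrite pnatr_eq0.
have := eta_x_xi_y_relation Ub two0.
have K0 : k%:R != 0 :> R by rewrite pnatr_eq0.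
have K1 : k%:R - 1 != 0 :> R by rewrite -[k%:R]natr1 addrK pnatr_eq0.
rewrite coef1E; move: (k%:R : R) K0 K1 (pderiv _ _ b) (pderiv _ _ b) => K K0 K1 xy ex.
move=> E2 E1.
have xy0 : xy = 0.
  apply: (mulfI K0); apply: (@mulfI _ 3); first by rewrite pnatr_eq0.
  rewrite !mulr0 (_ : 3 * (K * xy) = K * xy * 2 ^+ 2 - K * xy * 1 ^+ 2); last by ring.
  by rewrite -E2 E1 subrr.
split=> //; move: E1; rewrite xy0 mulr0 mul0r => /eqP.
by rewrite !mulf_eq0 invr_eq0 (negPf K0) (negPf K1) (negPf two0) => /eqP.
Qed.

Let eta_x0 b : U b -> pderiv 0 (vcomp X 1) b = 0.
Proof. by case/eta_x_xi_y_eq0. Qed.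
Let xi_y0 b : U b -> pderiv 1 (vcomp X 0) b = 0.
Proof. by case/eta_x_xi_y_eq0. Qed.

Local Notation xi_ m := (iter m (pderiv 0) (vcomp X 0)).
Local Notation eta_ m := (iter m (pderiv 1) (vcomp X 1)).

(** At y' = 1, y'' = 0 the terms in xi cancel, thanks to C(k,2) = a_1, and k(k-3) eta_yy = 4 d (k-3)
    eta_y remains, where d is 1 for k = 4 and 0 otherwise. Finally d k = 4 d. *)
Lemma eta_yy_relation b : U b -> eta_ 2 b = (n == 0%N)%:R * eta_ 1 b.
Proof.
move=> Ub.
have [S hS E] := separated_prolong Uopen k4 smoothX eta_x0 xi_y0 (leqnn k).
have [p [p' [[pb pb'] [y1 y2 y3] [low top] dk dP]]] := shell_difference 0 Ub (oner_neq0 R).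
have y0 j : (2 <= j <= n.+2)%N -> jy p' j = 0.
  case/andP; rewrite leq_eqVlt => /orP[/eqP <- _ //|j2 jn].
  by rewrite y3 // j2 ltnS ltnW.
have S0 : S p' = 0 by apply: jet_ideal_eq0 hS y0.
have S1 : S p = 0.
  apply: jet_ideal_eq0 hS _ => j j2; rewrite low ?y0 //.
  by case/andP: j2.
move: dP; rewrite !E ?pb ?pb' // dk top S0 S1 (low 1%N) // y1.
rewrite /ratio_variation (separated_prolong2 Uopen k4 smoothX eta_x0 xi_y0) ?pb' //.
rewrite (separated_prolong1 Uopen k4 smoothX eta_x0 xi_y0) ?pb' // y1 y2.
rewrite /prolong_lead y1 pb' (xi_y0 Ub) natr_bin2 coef1E !expr1n.
rewrite -[pderiv 1 (vcomp X 1) b]/(eta_ 1 b) -[pderiv 0 (vcomp X 0) b]/(xi_ 1 b).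
have -> : n.+3%:R = k%:R - 1 :> R by apply/eqP; rewrite eq_sym subr_eq natr1.
have -> : n.+1%:R = k%:R - 3 :> R.
  by apply/eqP; rewrite eq_sym subr_eq -natrD addn3.
have K3 : k%:R - 3 != 0 :> R.
  by rewrite subr_eq0 eqr_nat.
have K0 : k%:R != 0 :> R by rewrite pnatr_eq0.
have dK : (n == 0%N)%:R * k%:R = (n == 0%N)%:R * 4 :> R.
  by case: eqVneq => [->|]; rewrite ?mul0r.
move: (eta_ k b) (xi_ k b) (jy p' k) (jy p' n.+3) => ek xk yk yk'.
move: (xi_ 2 b) (eta_ 2 b) (xi_ 1 b) (eta_ 1 b) K3 K0 dK.
move: (k%:R : R) ((n == 0%N)%:R : R) => K d x2 e2 x1 e1 K3 K0 dK H.
apply: (mulfI K0); apply: (mulfI K3).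
have -> : K * (d * e1) = 4 * (d * e1) by rewrite mulrA [K * d]mulrC dK; ring.
apply/eqP; rewrite -subr_eq0; apply/eqP.
move/eqP: H; rewrite -subr_eq0 => /eqP H.
rewrite -[RHS](mulr0 (-2)) -[in RHS]H.
by field.
Qed.

(** The symmetry condition at y' = t, y'' = ... = y^(k-1) = 0, where the equation forces y^(k) = -y
    t^k, divided by t. The terms in xi_x cancel. *)
Lemma flat_relation b (t : R) : U b -> t != 0 ->
  t ^+ n.+3 * (n.+3%:R * b 0 1 * eta_ 1 b + eta_ k b + eta_ 0 b + 2 * eta_ 3 b) -
  2 * xi_ 3 b * t ^+ n.+1 = xi_ k b.
Proof.
move=> Ub t0.
have [S hS Ek] := separated_prolong Uopen k4 smoothX eta_x0 xi_y0 (leqnn k).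
have [T hT E3] := separated_prolong Uopen k4 smoothX eta_x0 xi_y0 (i := 0) (ltnW k4).
have [p [pb py pk]] := shell_jet n a b (fun i => if i == 1%N then t else 0).
have Up : U (jbase p) by rewrite pb.
have y1 : jy p 1 = t by rewrite py.
have y0 i : (1 < i < k)%N -> jy p i = 0.
  by case: i => [|[|i]] // ik; rewrite py.
have yp : jy p 0 = b 0 1 by rewrite -jy0 pb.
have S0 : S p = 0.
  by apply: jet_ideal_eq0 hS _ => j /andP[j2 jn]; rewrite y0 // j2 ltnS ltnW.
have T0 : T p = 0 by apply: jet_ideal_eq0 hT _ => -[|[|[|j]]].
have sub_lt i : (1 <= i < n.+3)%N -> (1 < k - i < k)%N.
  by move=> /andP[i1 i2]; rewrite ltn_subRL addnC ltn_subrL i1 andbT.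
have ykE : jy p k = - (b 0 1 * t ^+ k).
  rewrite pk /ode_rhs big_nat big1 => [|i /sub_lt iP].
    by rewrite (y0 3%N) // (y0 2%N) // y1 yp expr0n /= !mulr0 mul0r !subr0 add0r.
  by rewrite (y0 (k - i)%N) // !mulr0.
have := shell_prolong Up; rewrite y1 => /(_ t0 pk).
rewrite Ek // S0 ykE /ode_rhs_variation big_nat big1 => [|i iP]; last first.
  rewrite (y0 (k - i)%N) ?sub_lt // mulr0 add0r y0 // mul0r.
  by case: i iP => // i _; rewrite exprS !mul0r mulr0.
rewrite (y0 n.+3) ?ltnSn // (y0 3%N) // (y0 2%N) // y1 yp.
rewrite E3 // T0 (y0 3%N) // (y0 2%N) // y1.
rewrite (separated_prolong1 Uopen k4 smoothX eta_x0 xi_y0) // y1 separated_prolong0 pb.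
have -> : n.+3%:R = k%:R - 1 :> R by apply/eqP; rewrite eq_sym subr_eq natr1.
move: (eta_ k b) (xi_ k b) (b 0 1) => ek xk y.
move: (xi_ 3 b) (eta_ 3 b) (xi_ 2 b) (eta_ 2 b) (xi_ 1 b) (eta_ 1 b) (eta_ 0 b).
rewrite !(exprS t n.+3) !(exprS t n.+2) !(exprS t n.+1) !(exprS t n) .
move: (k%:R : R) (n.+1%:R : R) (t ^+ n) => K N tn x3 e3 x2 e2 x1 e1 e0 H.
apply: (mulfI t0); apply/eqP; rewrite -subr_eq0; apply/eqP.
move/eqP: H; rewrite -subr_eq0 => /eqP H.
rewrite -[RHS]H; ring.
Qed.

(* [flat_relation] at t = 1, 2, 4 is a nonsingular linear system. *)
Lemma xi_xxx_eta_relation b : U b ->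
  xi_ 3 b = 0 /\
  n.+3%:R * b 0 1 * eta_ 1 b + eta_ k b + eta_ 0 b + 2 * eta_ 3 b = 0.
Proof.
move=> Ub.
have n0 m : m.+1%:R != 0 :> R by rewrite pnatr_eq0.
have := flat_relation Ub (oner_neq0 R).
have := flat_relation Ub (n0 1%N); have := flat_relation Ub (n0 3%N).
(* With c = 2^(n+1), the powers t^(n+3) and t^(n+1) are 4c and c at t = 2, and 16c^2 and c^2 at t =
   4. *)
rewrite -[4]/((2 * 2)%N%:R) natrM !exprMn !expr1n.
rewrite !(exprS _ n.+2) !(exprS _ n.+1).
have c1 : (2 : R) ^+ n.+1 != 1.
  by rewrite gt_eqF // exprn_egt1 // ltr1n.
have c0 : (2 : R) ^+ n.+1 != 0 by rewrite expf_neq0.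
have c4 : 4 * (2 : R) ^+ n.+1 - 1 != 0.
  rewrite subr_eq0 -natrX -natrM (eqr_nat _ _ 1); apply/negP => /eqP E.
  by have := congr1 odd E; rewrite oddM.
move: ((2 : R) ^+ n.+1) c1 c0 c4 => c c1 c0 c4.
move: (_ + 2 * eta_ 3 b) (xi_ 3 b) (xi_ k b) => P m x E4 E2 E1.
have m0 : m = 0.
  have c1' : c - 1 != 0 by rewrite subr_eq0.
  apply: (mulfI c0); apply: (mulfI c1'); apply: (@mulfI _ 6) => //.
  rewrite !mulr0.
  have F1 : (4 * c - 1) * P = (c - 1) * (2 * m).
    apply/eqP; rewrite -subr_eq0; apply/eqP.
    by transitivity (x - x); [rewrite -{1}E2 -E1; ring|rewrite subrr].
  have F2 : (16 * c ^+ 2 - 1) * P = (c ^+ 2 - 1) * (2 * m).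
    apply/eqP; rewrite -subr_eq0; apply/eqP.
    by transitivity (x - x); [rewrite -{1}E4 -E1; ring|rewrite subrr].
  (* Since (4c+1)(4c-1) = 16c^2 - 1, this combination of [F1] and [F2] eliminates [P] and leaves
     6c(c-1)m = 0. *)
  transitivity ((4 * c + 1) * ((c - 1) * (2 * m)) - (c ^+ 2 - 1) * (2 * m)); first by ring.
  by rewrite -F1 -F2; ring.
split=> //; apply: (mulfI c4); rewrite mulr0.
apply/eqP; rewrite -subr_eq0; apply/eqP.
transitivity (x - x); last by rewrite subrr.
by rewrite -{1}E2 -E1 m0; ring.
Qed.

Lemma pderiv1_eq f c b : has_wderiv (fun j => (j == 1)%:R) b f c -> pderiv 1 f b = c.
Proof.
move=> [_ <-]; rewrite /wderiv big_ord_recl big_ord1 mul0r add0r.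
have -> : lift ord0 ord0 = 1 :> 'I_2 by exact/val_inj.
by rewrite eqxx mul1r.
Qed.

(** Repeated y-differentiation of eta_yy = d eta_y; the factor d is 0 or 1, hence idempotent. *)
Lemma eta_iterE m b : U b -> eta_ m.+2 b = (n == 0%N)%:R * eta_ 1 b.
Proof.
set d := (n == 0%N)%:R.
have dd : d * d = d by rewrite /d; case: eqP => _; rewrite ?mulr1 ?mulr0.
elim: m b => [|m IH] b Ub; first exact: eta_yy_relation.
have /(pderiv_zero_on Uopen 1)/(_ Ub) : forall q, U q -> eta_ m.+2 q - d * eta_ 1 q = 0.
  by move=> q Uq; rewrite IH // subrr.
have hE i : has_wderiv (fun j => (j == 1)%:R) b (eta_ i) (eta_ i.+1 b).
  apply: has_wderiv_eq (has_wderiv_smooth _ (smooth_eta smoothX i) Ub) _.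
  by rewrite mul0r add0r mul1r.
rewrite (pderiv1_eq (has_wderivB (hE m.+2)
  (has_wderivM (has_wderiv_cst _ _ d) (hE 1%N)))).
move=> /eqP; rewrite mul0r add0r subr_eq0 => /eqP ->.
by rewrite eta_yy_relation // mulrA dd.
Qed.

(** [r0] is ((k-1) y + 3d) eta_y + eta = 0, with 3d collecting eta_{y^k} + 2 eta_yyy. Its
    y-derivative gives k eta_y = d eta ([r1]), and another one gives (k-1) d eta_y = 0 ([r2]). So
    eta_y = 0, by [r1] if d = 0 and by [r2] if d = 1, and [r0] yields eta = 0. *)
Lemma eta_eq0 b : U b -> vcomp X 1 b = 0.
Proof.
set d := (n == 0%N)%:R : R.
have dd : d * d = d by rewrite /d; case: eqP => _; rewrite ?mulr1 ?mulr0.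
have kE : k%:R = n.+3%:R + 1 :> R by rewrite natr1.
have hE i q : U q -> has_wderiv (fun j => (j == 1)%:R) q (eta_ i) (eta_ i.+1 q).
  move=> Uq; apply: has_wderiv_eq (has_wderiv_smooth _ (smooth_eta smoothX i) Uq) _.
  by rewrite mul0r add0r mul1r.
have r0 q : U q -> (n.+3%:R * q 0 1 + 3 * d) * eta_ 1 q + eta_ 0 q = 0.
  move=> Uq; have [_ <-] := xi_xxx_eta_relation Uq.
  rewrite (eta_iterE n.+2) // (eta_iterE 1) // -/d.
  by move: (eta_ 1 q) (eta_ 0 q) (q 0 1) (n.+3%:R : R) => *; ring.
have r1 q : U q -> k%:R * eta_ 1 q = d * eta_ 0 q.
  move=> Uq; have := pderiv_zero_on Uopen 1 r0 Uq.
  rewrite (pderiv1_eq (has_wderivD (has_wderivM (has_wderivD (has_wderivM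
    (has_wderiv_cst _ _ _) (has_wderiv_coord _ _ 1)) (has_wderiv_cst _ _ _))
    (hE 1%N q Uq)) (hE 0%N q Uq))).
  rewrite (eta_iterE 0) // -/d kE (_ : (1 == 1 :> 'I_2)%:R = 1 :> R) //; move: (r0 q Uq).
  move: (eta_ 1 q) (eta_ 0 q) (q 0 1) (n.+3%:R : R) => e1 e0 y K E1 E2.
  apply/eqP; rewrite -subr_eq0; apply/eqP; rewrite -[RHS]E2.
  have -> : e0 = - ((K * y + 3 * d) * e1).
    by apply/eqP; rewrite -subr_eq0 opprK addrC E1.
  ring.
have r2 q : U q -> d * eta_ 1 q = 0.
  move=> Uq.
  have /(pderiv_zero_on Uopen 1)/(_ Uq) : forall q, U q -> k%:R * eta_ 1 q - d * eta_ 0 q = 0.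
    by move=> x Ux; rewrite r1 // subrr.
  rewrite (pderiv1_eq (has_wderivB
    (has_wderivM (has_wderiv_cst _ _ _) (hE 1%N q Uq))
    (has_wderivM (has_wderiv_cst _ _ _) (hE 0%N q Uq)))).
  rewrite (eta_iterE 0) // -/d kE => E.
  apply: (@mulfI _ n.+3%:R); first by rewrite pnatr_eq0.
  by rewrite mulr0 -[RHS]E; ring.
move=> Ub.
have e1 : eta_ 1 b = 0.
  apply: (@mulfI _ k%:R); first by rewrite pnatr_eq0.
  have := r2 b Ub; rewrite r1 // /d; case: eqP => _; last by rewrite !mul0r mulr0.
  by rewrite !mul1r => e; move: (r0 b Ub); rewrite e mulr0 add0r => ->; rewrite mulr0.
by have := r0 b Ub; rewrite e1 mulr0 add0r.
Qed.

(** Three integrations: xi_xx, then xi_x - 2 c2 x, then xi - c2 x^2 - c1 x have vanishing partial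
    derivatives on the connected set [U], so each equals its value at [b0]. *)
Lemma xi_quadratic : connected U -> U !=set0 -> exists c0 c1 c2, forall b, U b ->
  vcomp X 0 b = c0 + c1 * b 0 0 + c2 * b 0 0 ^+ 2.
Proof.
move=> Uc [b0 Ub0].
have hX i w b : U b -> has_wderiv w b (xi_ i) (w 0 * xi_ i.+1 b).
  move=> Ub; apply: has_wderiv_eq (has_wderiv_smooth _ (smooth_xi smoothX i) Ub) _.
  by rewrite (xi_pderiv1 Uopen smoothX xi_y0 i Ub) mulr0 addr0.
pose c2 := xi_ 2 b0 / 2.
have E2 b : U b -> xi_ 2 b = 2 * c2.
  move=> Ub; have -> : 2 * c2 = xi_ 2 b0 by rewrite /c2; move: (xi_ 2 b0) => c; field.
  apply: (connected_cst_wderiv Uopen Uc _ Ub Ub0) => w q Uq.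
  apply: has_wderiv_eq (hX 2%N w q Uq) _.
  have [E3 _] := xi_xxx_eta_relation Uq.
  by rewrite -[RHS](mulr0 (w 0)) -[in RHS]E3.
pose c1 := xi_ 1 b0 - 2 * c2 * b0 0 0.
have E1 b : U b -> xi_ 1 b = c1 + 2 * c2 * b 0 0.
  move=> Ub; apply/eqP; rewrite -subr_eq; apply/eqP.
  apply: (connected_cst_wderiv (f := fun q => xi_ 1 q - 2 * c2 * q 0 0) Uopen Uc _ Ub Ub0).
  move=> w q Uq; apply: has_wderiv_eq (has_wderivB (hX 1%N w q Uq)
    (has_wderivM (has_wderiv_cst _ _ _) (has_wderiv_coord _ _ _))) _.
  by rewrite E2 // mul0r add0r mulrC subrr.
exists (xi_ 0 b0 - c1 * b0 0 0 - c2 * b0 0 0 ^+ 2), c1, c2 => b Ub.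
apply/eqP; rewrite -subr_eq -subr_eq; apply/eqP.
have := connected_cst_wderiv (f := fun q => xi_ 0 q - c2 * q 0 0 ^+ 2 - c1 * q 0 0)
  Uopen Uc _ Ub Ub0.
rewrite [in X in _ -> X](addrAC (xi_ 0 b0)); apply=> w q Uq.
apply: has_wderiv_eq (has_wderivB (has_wderivB (hX 0%N w q Uq)
    (has_wderivM (has_wderiv_cst _ _ _) (has_wderivX 2 (has_wderiv_coord _ _ _))))
    (has_wderivM (has_wderiv_cst _ _ _) (has_wderiv_coord _ _ _))) _.
rewrite E1 // expr1; move: (w 0) (q 0 0) (q 0 0 ^+ 2) => *; ring.
Qed.

End Necessity.
(** * Projective vector fields are symmetries *)

Section Sufficiency.
Context {R : realType} (n : nat) (a : nat -> R).
Local Notation k := n.+4.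
Hypothesis a_system : is_coef_system k a.

(** f(k-q) factors as (k-q)(k-q-1), which is twice the coefficient produced by prolonging
    y^(k-q). *)
Lemma coef_recurrence q : (0 < q <= n)%N ->
  q.+1%:R * a q.+1 + (k%:R - q%:R) * (k%:R - q%:R - 1) / 2 * a q = 0.
Proof.
move=> /andP[q0 qn]; have [_ + _] := a_system => /(_ q.+1).
rewrite ltnS q0 (_ : (k - 3 = n.+1)%N) // ltnS qn => /(_ isT).
rewrite /fcoef; have -> : q.+1%:R = q%:R + 1 :> R by rewrite natr1.
rewrite subn1 [q.+1.-1]/=; move: (a q.+1) (a q) (k%:R) (q%:R) => A B K Q E.
by apply: (@mulfI _ 2) => //; rewrite mulr0 -[RHS]E; field.
Qed.

Lemma coef_last : n.+3%:R * a n.+2 + 3 * a n.+1 = 0.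
Proof.
have [_ _] := a_system; rewrite /fcoef !subSS subn0.
have -> : n.+2%:R = k%:R - 2 :> R by apply/eqP; rewrite eq_sym subr_eq -natrD addn2.
have -> : n.+3%:R = k%:R - 1 :> R by apply/eqP; rewrite eq_sym subr_eq natr1.
move: (k%:R : R) (a n.+2) (a n.+1) => K A B E.
by apply: (@mulfI _ 2) => //; rewrite mulr0 -[RHS]E; ring.
Qed.

Variables (y e : nat -> R) (s g : R).
Hypothesis y1 : y 1 != 0.
(** The shape of the prolongation of xi(x) d/dx with xi''' = 0, where [s] stands for xi' and [g] for
    xi''. *)
Hypothesis eE : forall i, (i <= k)%N ->
  e i = - i%:R * s * y i - i%:R * (i%:R - 1) / 2 * g * y i.-1.

Let u := y 2 / y 1.
(** The monomials of the part in [g]: varying u^q produces [T q.-1], and varying y^(k-q) produces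
    [T q]. *)
Let T q := u ^+ q * y (k - q).-1.

Lemma ratio_variationE : ratio_variation y e = - s * u - g.
Proof.
rewrite /ratio_variation /u !eE //; move: (y 2) (y 1) y1 => y2 y1' ? /=.
by field.
Qed.

(* The recurrence defining [a] makes the terms in [g] telescope. *)
Lemma coef_telescope m : (m <= n)%N ->
  \sum_(1 <= q < m.+2) (q%:R * a q * T q.-1 +
     a q * ((k%:R - q%:R) * (k%:R - q%:R - 1) / 2) * T q) =
  a 1 * T 0 + a m.+1 * ((k%:R - m.+1%:R) * (k%:R - m.+1%:R - 1) / 2) * T m.+1.
Proof.
elim: m => [_|m IH mn]; first by rewrite big_nat1 mul1r.
rewrite big_nat_recr //= IH 1?ltnW //.
have := coef_recurrence (q := m.+1) mn.
move: (T m.+1) (T m.+2) (T 0) (a m.+1) (a m.+2) (a 1) => T1 T2 T0 A1 A2 A0.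
move: (m.+2%:R : R) ((_ - m.+1%:R) * _ / 2) ((_ - m.+2%:R) * _ / 2) => M c1 c2 E.
have -> : M * A2 = - (c1 * A1) by apply/eqP; rewrite -addr_eq0 E.
ring.
Qed.

(** As u y' = y'', the last two monomials coincide, and their total coefficient (k-1) a_(k-2) + 3
    a_(k-3) vanishes by the closing equation of the system. *)
Lemma coef_telescope_last :
  \sum_(1 <= q < n.+3) (q%:R * a q * T q.-1 +
     a q * ((k%:R - q%:R) * (k%:R - q%:R - 1) / 2) * T q) = a 1 * y n.+3.
Proof.
rewrite big_nat_recr //= coef_telescope //.
have -> : T n.+2 = T n.+1.
  have -> : T n.+2 = u ^+ n.+2 * y 1 by rewrite /T (_ : (k - n.+2)%N = 2) //; exact: (addnK n.+2 2).
  have -> : T n.+1 = u ^+ n.+1 * y 2 by rewrite /T (_ : (k - n.+1)%N = 3) //; exact: (addnK n.+1 3).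
  rewrite exprS; move: (u ^+ n.+1) => U.
  by rewrite /u; move: (y 1) (y 2) y1 => z x z0; field.
have -> : T 0 = y n.+3 by rewrite /T subn0 mul1r.
have kE : k%:R = n.+3%:R + 1 :> R by rewrite natr1.
have n1E : n.+1%:R = n.+3%:R - 2 :> R by apply/eqP; rewrite eq_sym subr_eq -natrD addn2.
have n2E : n.+2%:R = n.+3%:R - 1 :> R by apply/eqP; rewrite eq_sym subr_eq natr1.
rewrite kE n1E n2E; have := coef_last.
move: (n.+3%:R : R) (a n.+2) (a n.+1) (a 1) (T n.+1) (y n.+3) => N A B C t z E.
have -> : A = A + (N * A + 3 * B) - (N * A + 3 * B) by ring.
apply/eqP; rewrite -subr_eq0; apply/eqP; transitivity ((N * A + 3 * B) * t).
  by field.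
by rewrite E mul0r.
Qed.

(** Giving y^(i) weight i, every term of [ode_rhs] has weight k, which settles the part in [s]. In
    the part in [g] the Schwarzian terms cancel and the sum telescopes to a_1 y^(k-1), with a_1 =
    k(k-1)/2 as in e k. *)
Lemma ode_rhs_variationE : y k = ode_rhs n a y -> ode_rhs_variation n a y e = e k.
Proof.
move=> yk; rewrite /ode_rhs_variation ratio_variationE.
have -> : \sum_(1 <= q < n.+3) a q * (q%:R * u ^+ q.-1 * (- s * u - g) * y (k - q) +
      u ^+ q * e (k - q)) =
    - (k%:R * s) * \sum_(1 <= q < n.+3) a q * (u ^+ q * y (k - q)) - g * (a 1 * y n.+3).
  rewrite -coef_telescope_last !mulr_sumr -sumrB.
  rewrite big_nat [RHS]big_nat; apply: eq_bigr => -[|q] // /andP[_ qn].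
  have qk : (q.+1 <= k)%N := leq_trans (ltnW qn) (leqnSn _).
  rewrite eE ?leq_subr // natrB // /T [q.+1.-1]/= exprS.
  have -> : (k - q).-1 = (k - q.+1)%N by rewrite subnS.
  move: (y (k - q.+1)) (y (k - q.+1).-1) (u ^+ q) (a q.+1) (k%:R : R) (q.+1%:R : R) => *.
  by field.
rewrite !eE // yk /ode_rhs -/u.
have kE : k%:R = n%:R + 4 :> R by rewrite -natrD addn4.
have n1E : n.+1%:R = n%:R + 1 :> R by rewrite natr1.
have nX : n%:R * y 1 ^+ n.-1 * y 1 = n%:R * y 1 ^+ n.
  by case: (n) => [|m]; rewrite ?mul0r // -mulrA -exprSr.
rewrite (coef1E a_system) kE n1E (exprS _ n.+3) (exprS _ n.+2) (exprS _ n.+1) (exprS _ n).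
set S := \sum_(_ <= _ < _) _; move: S => S.
have -> : y 2 ^+ 2 * (n%:R * y 1 ^+ n.-1 * (- 1 * s * y 1 - 1 * (1 - 1) / 2 * g * y 1.-1)) =
   - (y 2 ^+ 2 * s * (n%:R * y 1 ^+ n)) by rewrite -nX; ring.
move: (n%:R : R) (y 1 ^+ n) (y 0) (y 1) (y 2) (y 3) (y n.+3) => *.
by rewrite /=; field.
Qed.

End Sufficiency.

Section ProjectiveFields.
Context {R : realType} (n : nat) (a : nat -> R) (U : set 'rV[R]_2) (X : vfield R).
Local Notation k := n.+4.
Hypothesis Uopen : open U.
Hypothesis a_system : is_coef_system k a.
Hypothesis smoothX : forall j, smooth_on U (vcomp X j).
Hypothesis eta0 : forall b, U b -> vcomp X 1 b = 0.
Hypothesis xi_y0 : forall b, U b -> pderiv 1 (vcomp X 0) b = 0.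
Local Notation xi_ m := (iter m (pderiv 0) (vcomp X 0)).
Hypothesis xi_xxx0 : forall b, U b -> xi_ 3 b = 0.

Let k4 : (4 <= k)%N. Proof. by []. Qed.
Let eta_x0 b : U b -> pderiv 0 (vcomp X 1) b = 0.
Proof. exact: pderiv_zero_on. Qed.

(** Induction on i: the term in xi''' drops out, and the coefficients of xi'' add up as i(i-1)/2 + i
    = (i+1)i/2. *)
Lemma projective_prolong (p : jet R k) i : U (jbase p) -> (i <= k)%N ->
  prolong_coef X i p = - i%:R * xi_ 1 (jbase p) * jy p i -
    i%:R * (i%:R - 1) / 2 * xi_ 2 (jbase p) * jy p i.-1.
Proof.
move=> Up; case: i => [_|i ik]; first by rewrite oppr0 !mul0r !subr0 /= /eta eta0.
rewrite -natr1 addrK.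
elim: i ik p Up => [_|i IH ik] p Up.
  rewrite (separated_prolong1 Uopen k4 smoothX eta_x0 xi_y0 Up).
  have -> : iter 1 (pderiv 1) (vcomp X 1) (jbase p) = 0.
    exact: (pderiv_zero_on Uopen 1 eta0 Up).
  by jet_ring.
move: p Up; apply: (separated_step Uopen k4 smoothX xi_y0 (IH (ltnW ik))).
  have ik' : (i < k)%N by exact: ltnW.
  total_deriv_with ltac:(idtac; lazymatch goal with
    |- has_total_deriv _ (fun p => iter ?m _ _ (jbase p)) _ =>
      exact: (xi_total_deriv Uopen k4 smoothX xi_y0 m) end).
by move=> p Up; cbv beta; rewrite (xi_xxx0 Up) -natr1 [i.+1.-1]/= [i.+2.-1]/=; jet_atoms; field.
Qed.

Lemma projective_symmetry (p : jet R k) : U (jbase p) -> jy p 1 != 0 ->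
  ode k a p = 0 -> prolong X (ode k a) p = 0.
Proof.
move=> Up y1; rewrite odeE // => /eqP; rewrite subr_eq0 => /eqP yk.
rewrite prolong_ode // (ode_rhs_variationE (e := fun i => prolong_coef X i p)
  (s := xi_ 1 (jbase p)) (g := xi_ 2 (jbase p)) a_system y1 _ yk) ?subrr // => i ik.
exact: projective_prolong.
Qed.

End ProjectiveFields.

(** * Smoothness of quadratic polynomials in x *)

Section SmoothFields.
Context {R : realType} (U : set 'rV[R]_2).
Hypothesis Uopen : open U.
Implicit Types (b q : 'rV[R]_2) (f g : 'rV[R]_2 -> R).

Lemma near_eq_on f g b : (forall q, U q -> f q = g q) -> U b ->
  {near b, f =1 g}.
Proof.
by move=> fg Ub; near=> q; apply: fg; near: q; exact: open_nbhs_nbhs.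
Unshelve. all: by end_near. Qed.

Lemma eq_pderiv_on f g j b : (forall q, U q -> f q = g q) -> U b ->
  pderiv j f b = pderiv j g b.
Proof. by move=> fg Ub; apply: near_eq_derive; apply: near_eq_on. Qed.

Lemma eq_Ck_on m f g : (forall q, U q -> f q = g q) -> Ck_on m U f -> Ck_on m U g.
Proof.
have cts f' g' : (forall q, U q -> f' q = g' q) ->
    (forall b, U b -> {for b, continuous f'}) ->
    (forall b, U b -> {for b, continuous g'}).
  move=> fg cf b Ub; rewrite /prop_for /continuous_at -fg //.
  apply: (@cvg_trans _ (f' @ b)); last exact: cf.
  exact: (near_eq_cvg (near_eq_on fg Ub)).
elim: m f g => [|m IH] f g fg [cf df]; split=> //; try exact: cts fg cf.
move=> j; split=> [b Ub|].
  apply: near_eq_derivable ((df j).1 b Ub); exact: near_eq_on.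
by apply: IH (df j).2 => b Ub; exact: eq_pderiv_on.
Qed.

Definition quadratic c0 c1 c2 b : R := c0 + c1 * b 0 0 + c2 * b 0 0 ^+ 2.

Lemma has_wderiv_quadratic w c0 c1 c2 b :
  has_wderiv w b (quadratic c0 c1 c2) (w 0 * (c1 + 2 * c2 * b 0 0)).
Proof.
apply: has_wderiv_eq (has_wderivD (has_wderivD (has_wderiv_cst _ _ _)
  (has_wderivM (has_wderiv_cst _ _ _) (has_wderiv_coord _ _ _)))
  (has_wderivM (has_wderiv_cst _ _ _) (has_wderivX 2 (has_wderiv_coord _ _ _)))) _.
by rewrite expr1; move: (w 0) (b 0 0) (b 0 0 ^+ 2) => *; ring.
Qed.

Lemma pderiv_quadratic j c0 c1 c2 : pderiv j (quadratic c0 c1 c2) =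
  quadratic ((j == 0)%:R * c1) ((j == 0)%:R * (2 * c2)) 0.
Proof.
apply/funext => b; have [_] := has_wderiv_quadratic (fun i => (i == j)%:R) c0 c1 c2 b.
rewrite /wderiv (bigD1 j) //= eqxx mul1r big1 ?addr0 => [->|i /negPf ->]; last first.
  by rewrite mul0r.
rewrite /quadratic [0 == j]eq_sym; move: (b 0 0) ((j == 0)%:R) => *; ring.
Qed.

Lemma continuous_quadratic c0 c1 c2 : continuous (quadratic c0 c1 c2).
Proof.
move=> b; have cx : (fun q : 'rV[R]_2 => q 0 0) @ b --> b 0 0.
  exact: coord_continuous.
have cc (c : R) : (fun _ : 'rV[R]_2 => c) @ b --> c := @cst_continuous _ _ c b.
have E : quadratic c0 c1 c2 = (fun=> c0) + (fun=> c1) * (fun q => q 0 0)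
    + (fun=> c2) * ((fun q => q 0 0) * (fun q => q 0 0)).
  by apply/funext => q; rewrite /quadratic expr2.
rewrite /continuous_at E.
exact: cvgD (cvgD (cc c0) (cvgM (cc c1) cx)) (cvgM (cc c2) (cvgM cx cx)).
Qed.

(** The family is stable under partial derivatives, so the induction on the order of smoothness runs
    over all coefficients at once. *)
Lemma smooth_quadratic c0 c1 c2 : smooth_on U (quadratic c0 c1 c2).
Proof.
move=> m; elim: m c0 c1 c2 => [|m IH] c0 c1 c2;
  (split; first by move=> b _; exact: continuous_quadratic) => //.
move=> j; split=> [b _|]; last by rewrite pderiv_quadratic.
by case: (has_wderiv_quadratic (fun=> 0) c0 c1 c2 b).
Qed.

End SmoothFields.

(** * The isomorphism with sl(2) *)

Section LieIsomorphism.
Context {R : realType}.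

(** An injective bracket-preserving parametrisation transports the Lie algebra axioms from [M] to
    its image, so that the Jacobi identity for fields follows from that for matrices. The
    isomorphism is the inverse of [psi]. *)
Lemma lie_isomorphic_param (V W : lmodType R) (brV : V -> V -> V) (L : set V)
    (brW : W -> W -> W) (M : set W) (psi : W -> V) :
  is_lie_algebra brW M ->
  (forall c u v, M u -> M v -> psi (c *: u + v) = c *: psi u + psi v) ->
  (forall u v, M u -> M v -> psi u = psi v -> u = v) ->
  (forall u v, M u -> M v -> brV (psi u) (psi v) = psi (brW u v)) ->
  L = psi @` M ->
  lie_isomorphic brV L brW M.
Proof.
move=> lieM psiL psiI psiB LE; have [[M0 ML MB] bil alt jac] := lieM.
have psi0 : psi 0 = 0.
  by have := psiL (-1) 0 0 M0 M0; rewrite scaler0 addr0 scaleN1r addNr.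
have psiD u v : M u -> M v -> psi (u + v) = psi u + psi v.
  by move=> Mu Mv; have := psiL 1 u v Mu Mv; rewrite !scale1r.
have MD u v : M u -> M v -> M (u + v).
  by move=> Mu Mv; have := ML 1 u v Mu Mv; rewrite scale1r.
(* The inverse of [psi] on its image, with default value 0 elsewhere. *)
pose phi (v : V) : W := xget 0 [set u | M u /\ psi u = v].
have phiK u : M u -> phi (psi u) = u.
  by move=> Mu; apply: xget_unique => // v [Mv /psiI]; apply.
have LP v : L v -> exists2 u, M u & v = psi u.
  by rewrite LE => -[u Mu <-]; exists u.
have LI u : M u -> L (psi u) by move=> Mu; rewrite LE; exists u.
split=> //.
  split.
  - split=> [|c u v /LP[u' Mu ->] /LP[v' Mv ->]|u v /LP[u' Mu ->] /LP[v' Mv ->]].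
    + by rewrite -psi0; apply: LI.
    + by rewrite -psiL //; apply: LI; apply: ML.
    + by rewrite psiB //; apply: LI; apply: MB.
  - move=> c u v w /LP[u' Mu ->] /LP[v' Mv ->] /LP[w' Mw ->].
    have [E1 E2] := bil c u' v' w' Mu Mv Mw.
    have Muv := ML c _ _ Mu Mv.
    have [Muw Mvw] := (MB _ _ Mu Mw, MB _ _ Mv Mw).
    have [Mwu Mwv] := (MB _ _ Mw Mu, MB _ _ Mw Mv).
    by rewrite -psiL // !psiB // E1 E2 !psiL.
  - by move=> u /LP[u' Mu ->]; rewrite psiB // alt.
  - move=> u v w /LP[u' Mu ->] /LP[v' Mv ->] /LP[w' Mw ->].
    have [Muv Mvw Mwu] := And3 (MB _ _ Mu Mv) (MB _ _ Mv Mw) (MB _ _ Mw Mu).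
    have [M1 M2 M3] := And3 (MB _ _ Mu Mvw) (MB _ _ Mv Mwu) (MB _ _ Mw Muv).
    by rewrite !psiB // -!psiD ?jac //; exact: MD.
exists phi; split.
- split.
  + by move=> v /LP[u Mu ->]; rewrite phiK.
  + by move=> v w /set_mem/LP[u Mu ->] /set_mem/LP[x Mx ->]; rewrite !phiK // => ->.
  + by move=> u Mu; exists (psi u); [exact: LI|exact: phiK].
- move=> c u v /LP[u' Mu ->] /LP[v' Mv ->].
  by rewrite -psiL // !phiK //; apply: ML.
- move=> u v /LP[u' Mu ->] /LP[v' Mv ->].
  by rewrite psiB // !phiK //; apply: MB.
Qed.

Lemma sl2_lie_algebra : is_lie_algebra mx_commutator (sl2 R).
Proof.
rewrite /mx_commutator; split.
- split=> [|c A B|A B]; rewrite /sl2 /=.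
  + by rewrite mxtrace0.
  + by move=> A0 B0; rewrite mxtraceD mxtraceZ A0 B0 mulr0 addr0.
  + by move=> _ _; rewrite raddfB /= mxtrace_mulC subrr.
- move=> c A B C _ _ _.
  by rewrite !mulmxDl !mulmxDr -!scalemxAl -!scalemxAr !scalerBr; split;
    apply/matrixP => i j; rewrite !mxE; ring.
- by move=> A _; rewrite subrr.
- move=> A B C _ _ _; rewrite !mulmxBr !mulmxBl !mulmxA.
  by apply/matrixP => i j; rewrite !mxE; ring.
Qed.

End LieIsomorphism.

(** * The realization of sl(2) by projective fields in x *)

Section ProjectiveAction.
Context {R : realType} (U : set 'rV[R]_2).
Hypothesis Uopen : open U.
Implicit Types (A B : 'M[R]_2) (p : 'rV[R]_2).

Lemma sum_ord2 (F : 'I_2 -> R) : \sum_(j < 2) F j = F 0 + F 1.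
Proof.
by rewrite big_ord_recl big_ord1; congr (_ + F _); exact/val_inj.
Qed.

(* A = [[p, q], [r, -p]] acts by the field (q - 2 p x - r x^2) d/dx. *)
Definition sl2_coef A : 'rV[R]_2 -> R :=
  quadratic (A 0 1) (- 2 * A 0 0) (- A 1 0).

Definition sl2_field A : vfield R :=
  fun p => if `[< U p >] then \row_(i < 2) (if i == 0 then sl2_coef A p else 0)
           else 0.

Lemma sl2_field_xi A p : U p -> vcomp (sl2_field A) 0 p = sl2_coef A p.
Proof. by move=> Up; rewrite /vcomp /sl2_field (asboolT Up) mxE eqxx. Qed.

Lemma sl2_field_eta A p : U p -> vcomp (sl2_field A) 1 p = 0.
Proof. by move=> Up; rewrite /vcomp /sl2_field (asboolT Up) mxE. Qed.

Lemma sl2_field_out A p : ~ U p -> sl2_field A p = 0.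
Proof. by move=> Up; rewrite /sl2_field (asboolF Up). Qed.

Lemma sl2_field_eqP A (X : vfield R) : (forall p, ~ U p -> X p = 0) ->
  (forall p, U p -> vcomp X 0 p = sl2_coef A p) ->
  (forall p, U p -> vcomp X 1 p = 0) -> X = sl2_field A.
Proof.
move=> X0 Xxi Xeta; apply/funext => p.
have [Up|Up] := pselect (U p); last by rewrite X0 // sl2_field_out.
apply/rowP => j; have [->|->] := ord2_cases j.
  by have := Xxi p Up; rewrite -(sl2_field_xi A Up).
by have := Xeta p Up; rewrite -(sl2_field_eta A Up).
Qed.

Lemma sl2_field_linear c A B :
  sl2_field (c *: A + B) = c *: sl2_field A + sl2_field B.
Proof.
apply/esym/sl2_field_eqP => p Up.
- have E : (c *: sl2_field A + sl2_field B) p = c *: sl2_field A p + sl2_field B p by [].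
  by rewrite E !sl2_field_out // scaler0 addr0.
- have E : vcomp (c *: sl2_field A + sl2_field B) 0 p =
    c * vcomp (sl2_field A) 0 p + vcomp (sl2_field B) 0 p by rewrite /vcomp !mxE.
  rewrite E !sl2_field_xi // /sl2_coef /quadratic !mxE.
  by move: (A 0 1) (A 0 0) (A 1 0) (B 0 1) (B 0 0) (B 1 0) (p 0 0) => *; ring.
- have E : vcomp (c *: sl2_field A + sl2_field B) 1 p =
    c * vcomp (sl2_field A) 1 p + vcomp (sl2_field B) 1 p by rewrite /vcomp !mxE.
  by rewrite E !sl2_field_eta // mulr0 addr0.
Qed.

Lemma sl2_field_pderiv A j p : U p -> pderiv j (vcomp (sl2_field A) 0) p =
  quadratic ((j == 0)%:R * (- 2 * A 0 0)) ((j == 0)%:R * (2 * - A 1 0)) 0 p.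
Proof.
by move=> Up; rewrite (eq_pderiv_on Uopen _ (sl2_field_xi A) Up) pderiv_quadratic.
Qed.

Lemma sl2E A : sl2 R A -> A 1 1 = - A 0 0.
Proof.
by rewrite /sl2 /= /mxtrace sum_ord2 addrC => /eqP; rewrite addr_eq0 => /eqP.
Qed.

(** The second x-derivative, the first one and the value at one point of [U] determine the entries
    in turn; trace zero gives the last. *)
Lemma sl2_field_inj A B : U !=set0 -> sl2 R A -> sl2 R B ->
  sl2_field A = sl2_field B -> A = B.
Proof.
move=> [b Ub] tA tB AB.
have E1 p : U p -> pderiv 0 (vcomp (sl2_field A) 0) p = pderiv 0 (vcomp (sl2_field B) 0) p.
  by rewrite AB.
have E0 : sl2_coef A b = sl2_coef B b by rewrite -!sl2_field_xi // AB.
have := eq_pderiv_on Uopen 0 E1 Ub.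
have E p C : U p -> pderiv 0 (vcomp (sl2_field C) 0) p =
    quadratic (- 2 * C 0 0) (2 * - C 1 0) 0 p.
  by move=> Up; rewrite sl2_field_pderiv // eqxx !mul1r.
rewrite (eq_pderiv_on Uopen 0 (fun p => E p A) Ub) (eq_pderiv_on Uopen 0 (fun p => E p B) Ub).
rewrite !pderiv_quadratic eqxx !mul1r /quadratic !mulr0 !mul0r !addr0 => E2.
have e10 : A 1 0 = B 1 0.
  apply: (@mulfI _ (- 2)); first by rewrite oppr_eq0 pnatr_eq0.
  by move: E2; rewrite !mulrN !mulNr.
have e00 : A 0 0 = B 0 0.
  apply: (@mulfI _ (- 2)); first by rewrite oppr_eq0 pnatr_eq0.
  by have := E1 b Ub; rewrite !E // /quadratic e10 => /addIr/addIr.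
have e01 : A 0 1 = B 0 1.
  by move: E0; rewrite /sl2_coef /quadratic e10 e00 => /addIr/addIr.
apply/matrixP => i j.
have [->|->] := ord2_cases i; have [->|->] := ord2_cases j => //.
by rewrite !sl2E // e00.
Qed.

(** With the signs chosen in [sl2_coef] the action is a homomorphism, not an anti-homomorphism; once
    trace zero removes the last diagonal entries, a polynomial identity in x remains. *)
Lemma sl2_field_bracket A B : sl2 R A -> sl2 R B ->
  vf_bracket U (sl2_field A) (sl2_field B) = sl2_field (mx_commutator A B).
Proof.
move=> tA tB; apply: sl2_field_eqP => p Up.
- by rewrite /vf_bracket asboolF.
- rewrite /vcomp /vf_bracket (asboolT Up) mxE sum_ord2.
  rewrite !sl2_field_pderiv // !sl2_field_eta // !sl2_field_xi //.
  rewrite eqxx !mul1r !mul0r subrr addr0 /sl2_coef /quadratic /mx_commutator.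
  rewrite !mxE !sum_ord2 !sl2E //.
  by move: (A 0 1) (A 0 0) (A 1 0) (B 0 1) (B 0 0) (B 1 0) (p 0 0) => *; ring.
- rewrite /vcomp /vf_bracket (asboolT Up) mxE big1 // => j _.
  have E C q : U q -> vcomp (sl2_field C) 1 q = 0 by exact: sl2_field_eta.
  by rewrite !(pderiv_zero_on Uopen j (E _) Up) !mulr0 subrr.
Qed.

Lemma sl2_field_is_vfield A : is_vfield_on U (sl2_field A).
Proof.
split=> [j m|p Up]; last exact: sl2_field_out.
have [->|->] := ord2_cases j.
  apply: (eq_Ck_on Uopen (f := sl2_coef A)); last exact: smooth_quadratic.
  by move=> q Uq; rewrite sl2_field_xi.
apply: (eq_Ck_on Uopen (f := quadratic 0 0 0)); last exact: smooth_quadratic.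
move=> q Uq.
by rewrite sl2_field_eta // /quadratic !mul0r !addr0.
Qed.

Lemma sl2_field_symmetry n (a : nat -> R) A : is_coef_system n.+4 a ->
  point_symmetries (regular_jets n.+4) (ode n.+4 a) U (sl2_field A).
Proof.
move=> a_system; have vfA := sl2_field_is_vfield A.
split=> // p Up y1 Ep.
have xi1 q : U q -> pderiv 0 (vcomp (sl2_field A) 0) q =
    quadratic (- 2 * A 0 0) (2 * - A 1 0) 0 q.
  by move=> Uq; rewrite sl2_field_pderiv // eqxx !mul1r.
have xi2 q : U q -> pderiv 0 (pderiv 0 (vcomp (sl2_field A) 0)) q =
    quadratic (2 * - A 1 0) 0 0 q.
  move=> Uq; rewrite (eq_pderiv_on Uopen 0 xi1 Uq) pderiv_quadratic eqxx !mul1r.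
  by rewrite mulr0.
apply: (projective_symmetry Uopen a_system) => // [|q Uq|q Uq|q Uq].
- by case: vfA.
- exact: sl2_field_eta.
- by rewrite sl2_field_pderiv // !mul0r /quadratic !mul0r !addr0.
- rewrite [iter _ _ _]/= (eq_pderiv_on Uopen 0 xi2 Uq) pderiv_quadratic.
  by rewrite /quadratic !mulr0 !mul0r !addr0.
Qed.

Lemma point_symmetries_sl2 n (a : nat -> R) : connected U -> U !=set0 ->
  is_coef_system n.+4 a ->
  point_symmetries (regular_jets n.+4) (ode n.+4 a) U = sl2_field @` sl2 R.
Proof.
move=> Uc U0 a_system; apply/seteqP; split=> [X [[sX X0] symX]|_ [A _ <-]]; last first.
  exact: sl2_field_symmetry.
have symX' (p : jet R n.+4) : U (jbase p) -> jy p 1 != 0 -> ode n.+4 a p = 0 ->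
    prolong X (ode n.+4 a) p = 0 by move=> Up y1; exact: symX.
have [c0 [c1 [c2 xiE]]] := xi_quadratic Uopen a_system sX symX' Uc U0.
(* The traceless matrix whose [sl2_coef] is c0 + c1 x + c2 x^2. *)
pose A : 'M[R]_2 := \matrix_(i < 2, j < 2)
  if i == 0 then if j == 0 then - c1 / 2 else c0
  else if j == 0 then - c2 else c1 / 2.
exists A; first by rewrite /sl2 /= /mxtrace sum_ord2 !mxE /= mulNr addNr.
apply/esym/sl2_field_eqP => // p Up.
  rewrite xiE // /sl2_coef /quadratic !mxE /= opprK; congr (_ + _ * _ + _).
  by field.
exact: eta_eq0 Uopen a_system sX symX' _ Up.
Qed.

End ProjectiveAction.

Theorem mainTheorem3 (R : realType) (k : nat) (hk : (4 <= k)%N)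
    (a : nat -> R) (ha : is_coef_system k a)
    (U : set 'rV[R]_2) (hopen : open U) (hconn : connected U)
    (hne : U !=set0) :
  lie_isomorphic
    (vf_bracket U) (point_symmetries (regular_jets k) (ode k a) U)
    mx_commutator (sl2 R).
Proof.
case: k hk ha => [|[|[|[|n]]]] // _ ha.
apply: (lie_isomorphic_param (psi := sl2_field U)).
- exact: sl2_lie_algebra.
- by move=> c A B _ _; exact: sl2_field_linear.
- by move=> A B; exact: sl2_field_inj.
- by move=> A B; exact: sl2_field_bracket.
- exact: point_symmetries_sl2.
Qed.
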